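(* Let $d\ge 2$, let $S$ be a finite set, and let $\nu\in I_d(S)$ be a typical process. Let $h(\mathrm{vertex})$ denote the entropy of the marginal distribution of $\nu$ at a single vertex of $T_d$, and let $h(\mathrm{edge})$ denote the entropy of the joint marginal distribution of $\nu$ on the two endpoints of an edge of $T_d$. Then $$\frac d2\, h(\mathrm{edge})\ \ge\ (d-1)\,h(\mathrm{vertex}).$$
   Context: $T_d$ is the infinite $d$-regular tree. For a finite set $F$, $I_d(F)$ is the set of Borel probability measures on $F^{V(T_d)}$ invariant under $\mathrm{Aut}(T_d)$. The entropy of a probability distribution on a finite set with probabilities $p_1,\dots,p_K$ is $-\sum_i p_i\ln p_i$ (with $0\ln 0=0$). By invariance the entropies in the claim do not depend on the choice of vertex or edge. A sequence $\{G_i\}_{i=1}^\infty$ of finite $d$-regular graphs is a large girth sequence if for every $\varepsilon>0$ there is $n$ such that for all $i\ge n$ the probability that a uniformly random vertex of $G_i$ is contained in a cycle of length at most $\lceil 1/\varepsilon\rceil$ is at most $\varepsilon$. Colorings $f_i:V(G_i)\to F$ of a large girth sequence have Benjamini–Schramm limit $\mu\in I_d(F)$ if for every $r\in\mathbb N$ the law of the (isomorphism class of the) rooted $F$-colored ball of radius $r$ around a uniformly random vertex of $G_i$ converges weakly, as $i\to\infty$, to the law of the rooted $F$-colored ball of radius $r$ around a fixed vertex in a $\mu$-random coloring of $T_d$. For a large girth sequence $\mathcal S=\{G_i\}$, $[\mathcal S]_F$ is the set of all $\mu\in I_d(F)$ arising as Benjamini–Schramm limits of some sequence of $F$-colorings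 of $\mathcal S$. A process $\mu\in I_d(F)$ is typical if there is a fixed sequence of positive integers $n_i\to\infty$ (with $dn_i$ even) such that, for independent uniformly random $d$-regular graphs $\mathbb G_{n_i}$ on $n_i$ labelled vertices, $\mu\in[\{\mathbb G_{n_i}\}_{i=1}^\infty]_F$ holds with probability $1$. *)

(* Defs.v *)
From HB Require Import structures.
From mathcomp Require Import all_boot all_order all_algebra.
From mathcomp Require Import all_classical all_reals all_analysis.

Set Implicit Arguments.
Unset Strict Implicit.
Unset Printing Implicit Defensive.

Import Order.TTheory GRing.Theory Num.Theory.
Import numFieldNormedType.Exports.

Local Open Scope classical_set_scope.
Local Open Scope ring_scope.

(* Measurable types are pointed in the library, so the colour set carries a
   distinguished element; nothing below depends on which one. No case is lost:
   there is no probability measure on the colourings by an empty set. *)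
#[short(type="finPointedType")]
HB.structure Definition FinPointed := {T of Finite T & Pointed T}.

(* T_d as the Cayley graph of the free product of d copies of Z/2: vertices are
   the words over d letters with no two equal consecutive letters, and adding a
   letter in front moves to a neighbour. *)
Definition reduced (d : nat) (w : seq 'I_d) : bool :=
  sorted (fun a b : 'I_d => a != b) w.

Definition tree (d : nat) := {w : seq 'I_d | reduced w}.

Definition tree_root (d : nat) : tree d := exist _ [::] isT.

Definition tree_adj (d : nat) : rel (tree d) := fun x y =>
  [exists c, val y == c :: val x] || [exists c, val x == c :: val y].

Definition tree_aut (d : nat) (g : tree d -> tree d) : Prop :=
  bijective g /\ {mono g : x y / tree_adj x y}.

(* S^V(T_d) with the product of the discrete topologies, and its Borel sets *)
Definition coloring (d : nat) (S : finPointedType) :=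
  {ptws tree d -> discrete_topology S}.

Definition borel_coloring (d : nat) (S : finPointedType) :=
  g_sigma_algebraType (@open (coloring d S)).

Definition invariant_process (R : realType) (d : nat) (S : finPointedType)
    (mu : probability (borel_coloring d S) R) : Prop :=
  forall (g : tree d -> tree d) (A : set (borel_coloring d S)),
    tree_aut g -> measurable A -> mu [set w : borel_coloring d S | A (fun x => w (g x))] = mu A.

Record rcgraph (F : Type) := RCGraph {
  rc_vertex : Type;
  rc_adj : rel rc_vertex;
  rc_root : rc_vertex;
  rc_color : rc_vertex -> F }.

Definition rc_iso (F : Type) (A B : rcgraph F) : Prop :=
  exists h : rc_vertex A -> rc_vertex B,
    [/\ bijective h,
        h (rc_root A) = rc_root B,
        {mono h : x y / rc_adj x y} &
        forall x, rc_color (h x) = rc_color x].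

Definition rc_within (F : Type) (r : nat) (A : rcgraph F) (x : rc_vertex A) :
    Prop :=
  exists p : seq (rc_vertex A),
    [/\ path (@rc_adj F A) (rc_root A) p, last (rc_root A) p = x
      & (size p <= r)%N].

Lemma rc_within_root (F : Type) (r : nat) (A : rcgraph F) :
  rc_within r (rc_root A).
Proof. by exists [::]. Qed.

Definition rc_ball (F : Type) (r : nat) (A : rcgraph F) : rcgraph F :=
  @RCGraph F {x : rc_vertex A | rc_within r x}
    (fun x y => rc_adj (sval x) (sval y))
    (exist _ (rc_root A) (rc_within_root r A))
    (fun x => rc_color (sval x)).

(* a simple graph on 'I_n is the set of its ordered pairs of adjacent vertices *)
Definition is_regular_graph (d n : nat) (E : {set 'I_n * 'I_n}) : bool :=
  [&& [forall x, (x, x) \notin E],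
      [forall x, forall y, ((x, y) \in E) == ((y, x) \in E)]
    & [forall x, #|[set y | (x, y) \in E]%SET| == d]].

Definition regular_graph (d n : nat) := {E : {set 'I_n * 'I_n} | is_regular_graph d E}.

Definition graph_adj (d n : nat) (G : regular_graph d n) : rel 'I_n :=
  fun x y => (x, y) \in val G.

Section sequences.
Variables (R : realType) (d : nat) (ns : nat -> nat).
Implicit Type G : forall i, regular_graph d (ns i).

Definition in_short_cycle (n : nat) (H : regular_graph d n) (eps : R)
    (v : 'I_n) : Prop :=
  exists c : seq 'I_n,
    [/\ ucycle (graph_adj H) c, (3 <= size c)%N, v \in c
      & (size c)%:Z <= Num.ceil eps^-1].

Definition large_girth G : Prop :=
  forall eps : R, 0 < eps -> exists N : nat, forall i : nat, (N <= i)%N ->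
    #|[set v | `[< in_short_cycle (G i) eps v >]]%SET|%:R / (ns i)%:R <= eps.

(* There are countably many isomorphism classes of finite rooted coloured graphs
   and they form a discrete space: the bounded continuous functions are the
   bounded isomorphism-invariant functions. *)
Definition bs_limit (S : finPointedType) G (f : forall i, 'I_(ns i) -> S)
    (mu : probability (borel_coloring d S) R) : Prop :=
  forall (r : nat) (phi : rcgraph S -> R),
    (forall A B, rc_iso A B -> phi A = phi B) ->
    (exists M : R, forall A, `|phi A| <= M) ->
    (ns i)%:R^-1 *
      (\sum_(v < ns i) phi (rc_ball r (RCGraph (graph_adj (G i)) v (f i))))
      @[i --> \oo] -->
    \int[mu]_w phi (rc_ball r (RCGraph (@tree_adj d) (tree_root d) w)).

Definition limit_processes (S : finPointedType) G :
    set (probability (borel_coloring d S) R) :=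
  [set mu | [/\ large_girth G, invariant_process mu
              & exists f : forall i, 'I_(ns i) -> S, bs_limit G f mu]].

Definition independent_uniform (disp : measure_display)
    (Omega : measurableType disp) (P : probability Omega R)
    (G : forall i, Omega -> regular_graph d (ns i)) : Prop :=
  [/\ forall i (A : set (regular_graph d (ns i))), measurable (G i @^-1` A),
      forall i (H : regular_graph d (ns i)),
        P (G i @^-1` [set H]) = (#|{: regular_graph d (ns i)}|%:R^-1)%:E
    & forall (I : seq nat) (A : forall i, set (regular_graph d (ns i))),
        uniq I ->
        P (\bigcap_(i in [set` I]) (G i @^-1` A i)) =
        (\prod_(i <- I) P (G i @^-1` A i))%E].

End sequences.

(* The event depends only on the joint law of the family of random graphs, hence
   not on the probability space carrying it; asking for the existence of such a
   space also rules out sizes for which there is no d-regular graph. *)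
Definition typical (R : realType) (d : nat) (S : finPointedType)
    (mu : probability (borel_coloring d S) R) : Prop :=
  exists ns : nat -> nat,
    [/\ forall i, (0 < ns i)%N,
        forall i, ~~ odd (d * ns i),
        ns i @[i --> \oo] --> \oo
      & exists (disp : measure_display) (Omega : measurableType disp)
          (P : probability Omega R)
          (G : forall i, Omega -> regular_graph d (ns i)),
          independent_uniform P G /\
          {ae P, forall w, limit_processes (fun i => G i w) mu}].

Definition entropy (R : realType) (K : finType) (p : K -> R) : R :=
  - \sum_(k : K) p k * ln (p k).

Definition h_vertex (R : realType) (d : nat) (S : finPointedType)
    (mu : probability (borel_coloring d S) R) (v : tree d) : R :=
  entropy (fun a : S => fine (mu [set w : borel_coloring d S | w v = a])).

Definition h_edge (R : realType) (d : nat) (S : finPointedType)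
    (mu : probability (borel_coloring d S) R) (x y : tree d) : R :=
  entropy (fun ab : S * S =>
    fine (mu [set w : borel_coloring d S | w x = ab.1 /\ w y = ab.2])).

(* Main.v *)
(* First moment method. A regular graph on n vertices is encoded by a word listing
   the dn ends of its edges, in which every vertex occurs d times; every graph
   comes from the same number of words. A random word of this kind has a bounded
   expected number of loops and repeated edges, and each of them is destroyed by
   one transposition of two positions, so simple words make up a fraction at
   least 1/poly(n) of all words. For a fixed colouring with vertex frequencies p,
   the colour word of a random word is uniform on its type class, so the expected
   number of colourings with edge frequencies q and vertex marginal p is at most
   poly(n) * exp(n (H(p) + d/2 H(q) - d H(p))). If nu is typical, then with
   probability close to 1 the random graph has a colouring with edge frequencies
   close to the edge marginal of nu; hence the exponent cannot stay negative, and
   continuity of the entropy gives the inequality. *)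
Require Import Defs.
From HB Require Import structures.
From mathcomp Require Import all_boot all_order all_algebra all_fingroup.
From mathcomp Require Import all_classical all_reals all_analysis.
From mathcomp Require Import measurable_realfun.
From mathcomp Require Import zify ring lra.

Set Implicit Arguments.
Unset Strict Implicit.
Unset Printing Implicit Defensive.

Import Order.TTheory GRing.Theory Num.Theory.
Import numFieldNormedType.Exports.
Local Open Scope ring_scope.

(** * Words with d occurrences of every vertex *)

(** Everything is counted up to factors polynomial in n, because the exponent to be bounded is
    multiplied by n. This is why crude tools suffice: Markov's inequality and switchings in place of
    the limiting probability that a random word is simple, and Stirling bounds with polynomial
    error. The possible edge-frequency vectors are polynomially many too, so a pigeonhole selects
    one vector near the edge marginal, and no estimate uniform over a neighbourhood is required. The
    pairing of the positions into edges is fixed and all randomness lies in the labels. Permuting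
    positions is then a symmetry of the whole model, and each probability below reduces to comparing
    fibres that a permutation of positions maps into one another. In the exponent, H(p) counts the
    colourings, d/2 H(q) counts the colour words with one ordered pair of colours for every two
    positions, and -d H(p) comes from dividing by the size of a type class of words of length dn. *)

Section Words.
Local Open Scope nat_scope.
Variables (P V : finType) (flip : P -> P) (d : nat).
Hypothesis flipK : involutive flip.
Hypothesis flipN : forall p, flip p != p.
Implicit Types (w : {ffun P -> V}) (p q : P).

(** Configuration model: positions are half-edges, the orbits {p, [flip p]} of the fixed-point-free
    involution are the edges, and a word attaches the half-edges to vertices. *)
Definition words : {set {ffun P -> V}} :=
  [set w : {ffun P -> V} | [forall v, #|[set p | w p == v]%SET| == d]]%SET.

Definition permw w (s : {perm P}) : {ffun P -> V} := [ffun x => w (s x)].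

Definition dart w p : V * V := (w p, w (flip p)).

(* A pair [(p, flip p)] is a loop, any other pair is a repeated edge. *)
Definition bad_pairs w : {set P * P} :=
  [set pq : P * P | (pq.1 != pq.2) && (dart w pq.1 == dart w pq.2)]%SET.

Definition simple_words : {set {ffun P -> V}} :=
  [set w in words | #|bad_pairs w| == 0]%SET.

Lemma wordsP w : reflect (forall v, #|[set p | w p == v]%SET| = d) (w \in words).
Proof. by rewrite inE; apply: (iffP forallP) => h v; apply/eqP. Qed.

Lemma permw_words w s : (permw w s \in words) = (w \in words).
Proof.
have E v : #|[set p | permw w s p == v]%SET| = #|[set p | w p == v]%SET|.
  rewrite -(card_preimset [set p | w p == v]%SET (@perm_inj _ s)).
  by apply: eq_card => p; rewrite !inE ffunE.
by apply/wordsP/wordsP => h v; rewrite -(h v) E.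
Qed.

Lemma card_words_fiber (B : {set V}) w : w \in words ->
  #|[set p | w p \in B]%SET| = d * #|B|.
Proof.
move/wordsP => h; rewrite -sum1_card (partition_big w (mem B)) /=; last first.
  by move=> p; rewrite inE.
rewrite mulnC -sum_nat_const; apply: eq_bigr => v vB.
rewrite -(h v) -sum1_card; apply: eq_bigl => p; rewrite !inE.
by case: eqP => [->|]; rewrite ?vB ?andbF.
Qed.

(* The average over [q' \notin Z] of the number of [w \in Q] with [w q' = w p']
   is controlled by the fibre of [w p'], and all terms are equal. *)
Lemma card_collision (Q : {set {ffun P -> V}}) (Z : {set P}) p' :
  Q \subset words -> p' \in Z ->
  (forall w q r, w \in Q -> q \notin Z -> r \notin Z ->
     permw w (tperm q r) \in Q) ->
  forall q, q \notin Z ->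
  #|[set w in Q | w p' == w q]%SET| * #|~: Z| <= d * #|Q|.
Proof.
move=> QW p'Z Qperm q qZ.
have Eq r : r \notin Z -> #|[set w in Q | w p' == w q]%SET| <= #|[set w in Q | w p' == w r]%SET|.
  move=> rZ; rewrite -(card_imset (mem [set w in Q | w p' == w q]%SET)
     (f := fun w => permw w (tperm q r))); last first.
    move=> w1 w2 /ffunP e; apply/ffunP => x.
    by have := e (tperm q r x); rewrite !ffunE tpermK.
  apply: subset_leq_card; apply/fintype.subsetP => _ /imsetP [w + ->].
  rewrite inE => /andP [wQ /eqP e]; rewrite inE Qperm //= !ffunE tpermR.
  rewrite tpermD ?e //; [by apply: contraNneq qZ => ->|by apply: contraNneq rZ => ->].
rewrite mulnC -sum_nat_const.
apply: (@leq_trans (\sum_(r in ~: Z) #|[set w in Q | w p' == w r]%SET|)).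
  by apply: leq_sum => r; rewrite inE => rZ; apply: Eq.
under eq_bigr do rewrite -sum1_card.
rewrite (exchange_big_dep (mem Q)) /=; last by move=> r w _; rewrite inE => /andP[].
rewrite mulnC -sum_nat_const; apply: leq_sum => w wQ.
rewrite sum1_card.
have /wordsP/(_ (w p')) <- := fintype.subsetP QW _ wQ.
apply: subset_leq_card; apply/fintype.subsetP => r.
by rewrite unfold_in /= !inE eq_sym => /andP[_ /andP[_]].
Qed.

(** Loops: with p the only frozen position, the end [flip p] is as likely as any other to repeat
    [w p], which gives probability at most d / (#|P| - 1). *)
Lemma card_bad1 p : (#|[set w in words | w p == w (flip p)]%SET| * #|P|.-1 <= d * #|words|).
Proof.
have := @card_collision words [set p]%SET p (fintype.subxx _) _ _ (flip p).
rewrite cardsC1; apply; rewrite ?inE //.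
by move=> w q r wW _ _; rewrite permw_words.
Qed.

(** Repeated edges: the two coincidences of ends are imposed one after the other, each by
    [card_collision], with probabilities at most d / (#|P| - 1) and d / (#|P| - 3). *)
Lemma card_bad2 p q : q != p -> q != flip p -> 
  (#|[set w in words | dart w p == dart w q]%SET| * (#|P|.-1 * (#|P| - 3)) <= d ^ 2 * #|words|).
Proof.
move=> qp qfp.
have c1 : #|[set w in words | w p == w q]%SET| * #|P|.-1 <= d * #|words|.
  have := @card_collision words [set p]%SET p (fintype.subxx _) _ _ q.
  rewrite cardsC1; apply; rewrite ?inE //.
  by move=> w q' r wW _ _; rewrite permw_words.
have fqp : flip q != p by apply: contraNneq qfp => <-; rewrite flipK.
have fqfp : flip q != flip p by apply: contraNneq qp => /(can_inj flipK) ->.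
pose Q := [set w in words | w p == w q]%SET.
(* Freezing p and q keeps the first coincidence; [flip p] is frozen as the reference end, and
   [flip q] remains free. *)
pose Z := [set p; q; flip p]%SET.
have c2 : #|[set w in Q | w (flip p) == w (flip q)]%SET| * #|~: Z| <= d * #|Q|.
  apply: card_collision.
  - by apply/fintype.subsetP => w; rewrite inE => /andP[].
  - by rewrite !inE eqxx !orbT.
  - move=> w a b; rewrite [in w \in Q]inE => /andP [wW /eqP e] aZ bZ.
    have [a1 a2] : a != p /\ a != q by split; apply: contraNneq aZ => ->; rewrite !inE eqxx ?orbT.
    have [b1 b2] : b != p /\ b != q by split; apply: contraNneq bZ => ->; rewrite !inE eqxx ?orbT.
    by rewrite inE permw_words wW !ffunE /= !tpermD ?e.
  - by rewrite !inE !negb_or fqp fqfp flipN.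
have cZ : #|~: Z| = #|P| - 3.
  rewrite cardsCs finset.setCK /Z -finset.setUA cardsU1 cards2 !inE.
  by rewrite (eq_sym p q) (negPf qp) (eq_sym p) (negPf (flipN p)) qfp.
rewrite cZ in c2.
have -> : [set w in words | dart w p == dart w q]%SET = [set w in Q | w (flip p) == w (flip q)]%SET.
  by apply/setP => w; rewrite !inE xpair_eqE andbA.
rewrite (mulnC #|P|.-1) mulnA.
apply: (leq_trans (leq_mul c2 (leqnn _))).
by rewrite -mulnA expnS expn1 -mulnA leq_mul2l c1 orbT.
Qed.

(** There are #|P| pairs (p, [flip p]) of probability O(1/#|P|) and at most #|P|^2 other pairs of
    probability O(1/#|P|^2), so the mean is bounded. The factors 2 and 4 absorb N/(N-1) and
    N^2/((N-1)(N-3)) for N >= 6. *)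
Lemma sum_bad : 6 <= #|P| ->
  \sum_(w in words) #|bad_pairs w| <= (2 * d + 4 * d ^ 2) * #|words|.
Proof.
move=> P6.
have -> : \sum_(w in words) #|bad_pairs w| =
   \sum_(p : P) \sum_(q | q != p) #|[set w in words | dart w p == dart w q]%SET|.
  rewrite pair_big_dep /=.
  under eq_bigr do rewrite -sum1_card.
  under [RHS]eq_bigr do rewrite -sum1_card.
  rewrite (exchange_big_dep (fun pq : P * P => pq.2 != pq.1)) /=; last first.
    by move=> w pq _; rewrite inE eq_sym => /andP[].
  apply: eq_bigr => pq npq; apply: eq_bigl => w.
  by rewrite !inE eq_sym npq.
rewrite -(leq_pmul2r (m := #|P| ^ 2)) ?expn_gt0 ?(leq_trans _ P6) //.
have key p : (\sum_(q | q != p) #|[set w in words | dart w p == dart w q]%SET|) * #|P|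
   <= (2 * d + 4 * d ^ 2) * #|words|.
  rewrite (bigD1 (flip p)) //= mulnDl mulnDl leq_add //.
    apply: (@leq_trans (#|[set w in words | w p == w (flip p)]%SET| * #|P|)).
      rewrite leq_mul2r; apply/orP; right; apply: subset_leq_card.
      by apply/fintype.subsetP => w; rewrite !inE xpair_eqE => /and3P[-> ->].
    have := card_bad1 p. 
    move: (#|_|) (#|words|) => a b; move: P6; move: (#|P|) => N P6 h.
    have : a * N <= 2 * (a * N.-1) by nia.
    nia.
  rewrite -(leq_pmul2r (m := #|P|)) ?(leq_trans _ P6) // big_distrl /= big_distrl /=.
  apply: (@leq_trans (\sum_(q | (q != p) && (q != flip p)) (4 * d ^ 2 * #|words|))).
    apply: leq_sum => q /andP[q1 q2].
    have := card_bad2 q1 q2.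
    move: (#|_|) (#|words|) (d ^ 2) => a b e; move: P6; move: (#|P|) => N P6 h.
    have -> : a * N * N = a * (N * N) by rewrite mulnA.
    have : N * N <= 4 * (N.-1 * (N - 3)) by nia.
    move: h; move: (N.-1 * (N - 3)) (N * N) => x y; nia.
  rewrite sum_nat_const mulnC leq_mul2l; apply/orP; right; exact: max_card.
rewrite big_distrl /=.
apply: (@leq_trans (\sum_(p : P) (2 * d + 4 * d ^ 2) * #|words| * #|P|)).
  apply: leq_sum => p _; rewrite -mulnn mulnA leq_mul2r key orbT //.
by rewrite sum_nat_const -mulnn mulnC -mulnA.
Qed.

(** Markov's inequality at twice the mean bound of [sum_bad]. *)
Lemma half_few_bad : 6 <= #|P| ->
  #|words| <= 2 * #|[set w in words | #|bad_pairs w| <= 2 * (2 * d + 4 * d ^ 2)]%SET|.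
Proof.
move=> /sum_bad; set K := _ + _; set B := [set w in words | _]%SET => h.
have : \sum_(w in words :\: B) (2 * K).+1 <= K * #|words|.
  apply: leq_trans h; rewrite [X in _ <= X](big_setID B) /=; apply: leq_trans (leq_addl _ _).
  by apply: leq_sum => w; rewrite !inE => /andP[+ wW]; rewrite wW /= -ltnNge.
rewrite sum_nat_const cardsD.
have -> : words :&: B = B by apply/setP => w; rewrite !inE andbA andbb.
have BW : #|B| <= #|words|.
  by apply: subset_leq_card; apply/fintype.subsetP => w; rewrite inE => /andP[].
nia.
Qed.

Lemma dart_flip w p : dart w (flip p) = ((dart w p).2, (dart w p).1).
Proof. by rewrite /dart flipK. Qed.

(* Swap the end [w p] of a bad edge with the end [w q] of an edge far from it. *)
Lemma switching w : w \in words -> 0 < #|bad_pairs w| ->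
  d * (d + 2) + d * (d + 1) + #|bad_pairs w| < #|P| ->
  exists p q, #|bad_pairs (permw w (tperm p q))| < #|bad_pairs w|.
Proof.
move=> wW /card_gt0P [[p q0]]; rewrite inE /= => /andP[pq0 /eqP Epq0] big.
set u := w (flip p); set v := w p.
pose nb (a : V) := [set w (flip s) | s in [set s | w s == a]%SET]%SET.
have nbcard a : #|nb a| <= d.
  by apply: (leq_trans (leq_imset_card _ _)); move/wordsP : wW => ->.
(* The swap creates the edges {x, u} and {v, y}, where x = [w q] and y = [w (flip q)]. Avoiding u
   and [nb u] for x, and v and [nb v] for y, makes them neither loops nor repeats of old edges; x !=
   v and x != y ([B3]) keep them distinct from each other. The size hypothesis says that the
   forbidden positions do not exhaust [P]. *)
pose V1 := (u |: (v |: nb u))%SET; pose V2 := (v |: nb v)%SET.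
pose B1 := [set q | w q \in V1]%SET.
pose B2 := [set q | w (flip q) \in V2]%SET.
pose B3 := [set q | w q == w (flip q)]%SET.
have b1 : #|B1| <= d * (d + 2).
  rewrite card_words_fiber // leq_mul2l; apply/orP; right.
  rewrite !cardsU1; apply: (@leq_trans (1 + (1 + d))); last lia.
  by rewrite leq_add ?leq_b1 ?leq_add ?leq_b1.
have b2 : #|B2| <= d * (d + 1).
  have -> : #|B2| = #|[set q | w q \in V2]%SET|.
    rewrite -(card_preimset [set q | w q \in V2]%SET (can_inj flipK)).
    by apply: eq_card => q; rewrite !inE.
  rewrite card_words_fiber // leq_mul2l; apply/orP; right.
  rewrite !cardsU1 addnC; exact: (leq_add (nbcard _) (leq_b1 _)).
have b3 : #|B3| <= #|bad_pairs w|.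
  rewrite -(card_imset (mem B3) (f := fun q => (q, flip q))); last by move=> ? ? [].
  apply: subset_leq_card; apply/fintype.subsetP => _ /imsetP[q + ->].
  rewrite !inE /= => /eqP e; rewrite eq_sym flipN /= dart_flip /dart /=.
  by rewrite e eqxx.
have [q] : exists q, q \notin (B1 :|: B2 :|: B3)%SET.
  apply/existsP; apply: contraTT big; rewrite negb_exists => /forallP h.
  have -> : #|P| = #|(B1 :|: B2 :|: B3)%SET|.
    by apply/esym/eq_card => q; have := h q; rewrite negbK => ->.
  rewrite -leqNgt; apply: (leq_trans (leq_card_setU _ _)).
  by rewrite leq_add ?b3 //; apply: (leq_trans (leq_card_setU _ _)); rewrite leq_add.
rewrite !finset.in_setU !negb_or => /andP[/andP[q1 q2] q3].
set x := w q; set y := w (flip q).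
have [xu xv xnb] : [/\ x != u, x != v & x \notin nb u].
  by move: q1; rewrite inE /V1 !finset.in_setU1 !negb_or => /and3P[].
have [yv ynb] : y != v /\ y \notin nb v.
  by move: q2; rewrite inE /V2 finset.in_setU1 negb_or => /andP[].
have xy : x != y by move: q3; rewrite inE.
exists p, q; set w' := permw _ _.
have qfp : q != flip p by apply: contraNneq xu; rewrite /x /u => ->.
have qp : q != p by apply: contraNneq xv; rewrite /x /v => ->.
have fqp : flip q != p by apply: contraNneq qfp => <-; rewrite flipK.
have fqfp : flip q != flip p by apply: contraNneq qp => /(can_inj flipK) ->.
have Dp : dart w' p = (x, u).
  by rewrite /dart !ffunE tpermL tpermD // eq_sym.
have Dq : dart w' q = (v, y).
  by rewrite /dart !ffunE tpermR tpermD // eq_sym // flipN.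
have Ds s : s != p -> s != q -> s != flip p -> s != flip q -> dart w' s = dart w s.
  have flipE a : (flip s == a) = (s == flip a) by rewrite (can2_eq flipK flipK).
  by move=> s1 s2 s3 s4; rewrite /dart !ffunE !tpermD // eq_sym // flipE.
have nbE a s : w s = a -> w (flip s) \in nb a.
  by move=> e; apply/imsetP; exists s; rewrite ?inE ?e.
pose good r := forall s, s != r -> dart w' s != dart w' r.
have goodF r : good r -> good (flip r).
  move=> gr s sr; have := gr (flip s); rewrite !dart_flip.
  have -> : flip s != r by apply: contraNneq sr => <-; rewrite flipK.
  move=> /(_ isT); apply: contraNneq => ->; by case: (dart w' r).
have gp : good p.
  move=> s sp; rewrite Dp.
  have [->|s2] := eqVneq s q; first by rewrite Dq xpair_eqE negb_and eq_sym xv.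
  have [->|s3] := eqVneq s (flip p); first by rewrite dart_flip Dp xpair_eqE negb_and eq_sym xu.
  have [->|s4] := eqVneq s (flip q); first by rewrite dart_flip Dq xpair_eqE negb_and eq_sym xy.
  rewrite Ds // /dart xpair_eqE; apply: contraNN xnb => /andP[/eqP <- /eqP e].
  by have := nbE _ _ e; rewrite flipK.
have gq : good q.
  move=> s sq; rewrite Dq.
  have [->|s1] := eqVneq s p; first by rewrite Dp xpair_eqE negb_and xv.
  have [->|s3] := eqVneq s (flip p); first by rewrite dart_flip Dp xpair_eqE negb_and xy orbT.
  have [->|s4] := eqVneq s (flip q); first by rewrite dart_flip Dq xpair_eqE negb_and yv.
  rewrite Ds // /dart xpair_eqE; apply: contraNN ynb => /andP[/eqP e /eqP <-].
  exact: nbE.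
have gNbad r s : good r \/ good s -> (r, s) \notin bad_pairs w'.
  rewrite inE /= => g; rewrite negb_and negbK; have [//|rs /=] := eqVneq r s.
  by case: g => g; [rewrite eq_sym; apply: g; rewrite eq_sym|apply: g].
(* A bad pair of [w'] avoids the four touched positions, where all darts are now unique; elsewhere
   the darts are unchanged. So no bad pair is new, and (p, q0) is lost. *)
have key : bad_pairs w' \subset (bad_pairs w :\ (p, q0))%SET.
  apply/fintype.subsetP => [[r s] rs].
  have nr : ~ good r by move=> g; have := gNbad r s (or_introl g); rewrite rs.
  have ns : ~ good s by move=> g; have := gNbad r s (or_intror g); rewrite rs.
  have ne t : ~ good t -> [/\ t != p, t != q, t != flip p & t != flip q].
    by move=> nt; split; apply/eqP => e; apply: nt; rewrite e //; apply: goodF.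
  have [r1 r2 r3 r4] := ne r nr; have [s1 s2 s3 s4] := ne s ns.
  move: rs; rewrite !inE /= Ds // Ds // => ->.
  by rewrite xpair_eqE negb_and r1.
apply: (leq_ltn_trans (subset_leq_card key)).
by rewrite [X in _ < X](cardsD1 (p, q0)) inE /= pq0 Epq0 eqxx.
Qed.

(** Undoing a switching is again a transposition, so a word with at most k+1 bad pairs is one of
    #|P|^2 transposes of a word with at most k. Each level costs a factor #|P|^2. *)
Lemma card_few_bad k : d * (d + 2) + d * (d + 1) + k < #|P| ->
  #|[set w in words | #|bad_pairs w| <= k]%SET| <= #|P| ^ (2 * k) * #|simple_words|.
Proof.
elim: k => [|k IH] big.
  rewrite expn0 mul1n; apply: subset_leq_card; apply/fintype.subsetP => w.
  by rewrite !inE leqn0.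
apply: (@leq_trans (#|P| ^ 2 * #|[set w in words | #|bad_pairs w| <= k]%SET|)); last first.
  rewrite mulnS expnD -mulnA leq_mul2l IH ?orbT //; lia.
set B := [set w in words | _ <= k]%SET.
rewrite expnS expn1 -!card_prod -cardsT -cardsX.
apply: leq_trans (leq_imset_card (fun x => permw x.2 (tperm x.1.1 x.1.2)) _).
apply: subset_leq_card; apply/fintype.subsetP => w /setIdP[wW bw].
(* A word that is already simple has nothing to switch; the trivial transposition of p with itself
   serves. *)
have [b0|b0] := posnP #|bad_pairs w|.
  have [p _] : exists p : P, p \in P by apply/card_gt0P; apply: leq_ltn_trans big.
  apply/imsetP; exists ((p, p), w); first by rewrite inE /= [(p, p) \in _]inE inE wW b0.
  by apply/ffunP => z; rewrite ffunE tperm1 perm1.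
have [|p [q lt]] := switching wW b0; first by apply: leq_ltn_trans big; rewrite leq_add2l.
apply/imsetP; exists ((p, q), permw w (tperm p q)).
  apply/setXP; split; first by rewrite inE.
  by apply/setIdP; split; rewrite ?permw_words // -ltnS (leq_trans lt).
by apply/ffunP => z; rewrite !ffunE tpermK.
Qed.

Lemma card_words_le :
  let K := 2 * (2 * d + 4 * d ^ 2) in
  6 + d * (d + 2) + d * (d + 1) + K < #|P| ->
  #|words| <= 2 * #|P| ^ (2 * K) * #|simple_words|.
Proof.
move=> K big; apply: (leq_trans (half_few_bad _)); first by lia.
by rewrite -mulnA leq_mul2l card_few_bad ?orbT //; rewrite -/K; lia.
Qed.

End Words.

(** * Words of a regular graph *)

Section WordGraphs.
Local Open Scope nat_scope.
Variables (n d : nat).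
Let P := 'I_(d * n).
Let flip : P -> P := @rev_ord (d * n).
Hypothesis dn_even : ~~ odd (d * n).

Lemma rev_ord_neq p : flip p != p.
Proof.
apply/eqP => /(congr1 val) /= e; move: dn_even.
have -> : d * n = p.*2.+1 by have := ltn_ord p; lia.
by rewrite /= odd_double.
Qed.

Definition word_graph (w : {ffun P -> 'I_n}) : {set 'I_n * 'I_n} :=
  [set dart flip w p | p in P]%SET.

(** The centraliser of [flip]: the rearrangements of a word that permute its edges and exchange
    their ends. *)
Definition flip_perms : {set {perm P}} :=
  [set s : {perm P} | [forall p, s (flip p) == flip (s p)]]%SET.

Lemma simple_wordsP (w : {ffun P -> 'I_n}) :
  reflect (w \in words _ _ d /\ injective (dart flip w)) (w \in simple_words 'I_n flip d).
Proof.
apply: (iffP setIdP) => [[wW /eqP/cards0_eq b0]|[wW inj]]; split => //.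
  move=> p q e; apply/eqP; apply: contraT => pq.
  have : (p, q) \in bad_pairs flip w by rewrite inE pq e eqxx.
  by rewrite b0 inE.
rewrite cards_eq0; apply/eqP/setP => [[p q]]; rewrite !inE /=.
by apply/negP => /andP[pq /eqP/inj e]; rewrite e eqxx in pq.
Qed.

Let flipK : involutive flip := @rev_ordK _.

Lemma word_graph_regular w : w \in simple_words 'I_n flip d -> is_regular_graph d (word_graph w).
Proof.
move=> /simple_wordsP[wW inj]; apply/and3P; split.
- apply/forallP => x; apply/negP => /imsetP[p _ [e1 e2]].
  have /inj e : dart flip w (flip p) = dart flip w p by rewrite /dart flipK -e1 -e2.
  by have := rev_ord_neq p; rewrite e eqxx.
- have sym x y : (x, y) \in word_graph w -> (y, x) \in word_graph w.
    by move=> /imsetP[p _ [-> ->]]; apply/imsetP; exists (flip p); rewrite // /dart flipK.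
  by apply/forallP => x; apply/forallP => y; apply/eqP; apply/idP/idP; apply: sym.
- apply/forallP => x; apply/eqP; move/wordsP: wW => /(_ x); apply: etrans.
  rewrite -(card_in_imset (D := mem [set p | w p == x]%SET) (f := fun p => w (flip p))); last first.
    move=> p q; rewrite !inE => /eqP e1 /eqP e2 e3.
    by apply: inj; rewrite /dart e1 e2 e3.
  apply: eq_card => y; rewrite inE; apply/imsetP/imsetP => -[p].
    by move=> _ [-> ->]; exists p; rewrite ?inE.
  by rewrite inE => /eqP e ->; exists p; rewrite // /dart e.
Qed.

Lemma regular_simple_word w (E : {set 'I_n * 'I_n}) : is_regular_graph d E ->
  injective (dart flip w) -> word_graph w = E -> w \in simple_words 'I_n flip d.
Proof.
move=> /and3P[_ _ /forallP reg] inj wE; apply/simple_wordsP; split => //.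
apply/wordsP => x; apply: etrans (eqP (reg x)).
rewrite -(card_in_imset (D := mem [set p | w p == x]%SET) (f := fun p => w (flip p))); last first.
  move=> p q; rewrite !inE => /eqP e1 /eqP e2 e3.
  by apply: inj; rewrite /dart e1 e2 e3.
apply: eq_card => y; rewrite inE -wE; apply/imsetP/imsetP => -[p].
  by rewrite inE => /eqP e ->; exists p; rewrite // /dart e.
by move=> _ [-> ->]; exists p; rewrite ?inE.
Qed.

Lemma card_regular_graph (E : {set 'I_n * 'I_n}) : is_regular_graph d E -> #|E| = d * n.
Proof.
move=> /and3P[_ _ /forallP reg].
rewrite -sum1_card (partition_big fst predT) //=.
transitivity (\sum_(x < n) d); last by rewrite sum_nat_const card_ord mulnC.
apply: eq_bigr => x _; rewrite sum1_card; apply: etrans (eqP (reg x)).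
rewrite -(card_imset (mem [set y | (x, y) \in E]%SET) (f := pair x)); last by move=> ? ? [].
apply: eq_card => [[a b]]; rewrite unfold_in /=; apply/andP/imsetP => [[ab /eqP /= <-]|[y]].
  by exists b; rewrite ?inE.
by rewrite inE => xy [-> ->]; rewrite eqxx.
Qed.

(** The edges, oriented upwards, are listed on the first half of the positions, and [rev_ord]
    mirrors the opposite ends onto the second half. Darts increase on the first half and decrease on
    the second, so injectivity reduces to that of the enumeration. *)
Lemma exists_simple_word (E : {set 'I_n * 'I_n}) : is_regular_graph d E ->
  exists2 w, w \in simple_words 'I_n flip d & word_graph w = E.
Proof.
move=> reg.
(* Without vertices there is no default pair for [nth], so this case is separate. *)
have [n0|n_gt0] := posnP n.
  have noV (x : 'I_n) : False by case: x => x; rewrite n0.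
  have noP (p : P) : False by case: p => p; rewrite n0 muln0.
  pose w : {ffun P -> 'I_n} := [ffun p => False_rect _ (noP p)].
  have wE : word_graph w = E by apply/setP => [[x]]; case: (noV x).
  exists w => //.
  by apply: regular_simple_word reg _ wE => p; case: (noP p).
case/and3P: (reg) => /forallP irr /forallP sym0 _.
have sym x y : ((x, y) \in E) = ((y, x) \in E) by have /forallP/(_ y)/eqP := sym0 x.
pose x0 := (Ordinal n_gt0, Ordinal n_gt0).
pose L := [set xy in E | xy.1 < xy.2]%SET.
have cardL : #|L|.*2 = d * n.
  rewrite -(card_regular_graph reg) -addnn.
  rewrite -[in X in _ = X](cardsID L E); congr (_ + _).
    by apply: eq_card => xy; rewrite !inE andbA andbb.
  rewrite -(card_imset (mem L) (f := fun xy => (xy.2, xy.1))); last by move=> [? ?] [? ?] [-> ->].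
  apply: eq_card => [[x y]]; apply/imsetP/idP.
    move=> [[a b]]; rewrite !inE /= => /andP[ab lt] [-> ->].
    by rewrite -sym ab ltnNge (ltnW lt).
  rewrite !inE /= => /andP[+ xy]; rewrite xy /= -leqNgt => yx.
  exists (y, x) => //; rewrite inE /= -sym xy ltn_neqAle yx andbT /=.
  apply: contraNneq (irr x) => /val_inj e; by have := xy; rewrite e.
pose e := enum L; have se : size e = #|L| by rewrite -cardE.
pose w : {ffun P -> 'I_n} :=
  [ffun p : P => if p < #|L| then (nth x0 e p).1 else (nth x0 e (flip p)).2].
have half (p : P) : (flip p < #|L|) = ~~ (p < #|L|).
  have arith a b c : a.*2 = b -> c < b -> (b - c.+1 < a) = ~~ (c < a) by lia.
  exact: arith cardL (ltn_ord p).
have Dlo (p : P) : p < #|L| -> dart flip w p = nth x0 e p.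
  move=> pL; rewrite /dart !ffunE half pL flipK.
  by case: (nth _ _ _).
have Dhi (p : P) : ~~ (p < #|L|) -> dart flip w p = ((nth x0 e (flip p)).2, (nth x0 e (flip p)).1).
  by move=> pL; rewrite /dart !ffunE half (negPf pL).
have eL k : k < #|L| -> nth x0 e k \in L by move=> kL; rewrite -mem_enum mem_nth ?se.
have lo (p : P) : p < #|L| -> (dart flip w p).1 < (dart flip w p).2.
  by move=> pL; rewrite Dlo //; have := eL _ pL; rewrite inE => /andP[].
have hi (p : P) : ~~ (p < #|L|) -> (dart flip w p).2 < (dart flip w p).1.
  by move=> pL; rewrite Dhi //=; have := eL (flip p); rewrite half inE => /(_ pL)/andP[].
have inj : injective (dart flip w).
  move=> p q epq; case: (boolP (p < #|L|)) => pL.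
    have qL : q < #|L|.
      apply: contraT => /hi; rewrite -epq => h; have := lo _ pL.
      by rewrite ltnNge (ltnW h).
    move: epq; rewrite !Dlo // => /eqP; rewrite nth_uniq ?se ?enum_uniq // => /eqP.
    exact: val_inj.
  have qL : ~~ (q < #|L|).
    apply/negP => /lo; rewrite -epq => h; have := hi _ pL.
    by rewrite ltnNge (ltnW h).
  move: epq; rewrite !Dhi // => -[e1 e2].
  have : nth x0 e (flip p) = nth x0 e (flip q).
    by move: e1 e2; case: (nth _ _ _) => a b; case: (nth _ _ _) => a' b' /= -> ->.
  move/eqP; rewrite nth_uniq ?se ?enum_uniq ?half // => /eqP/val_inj.
  exact: (can_inj flipK).
have wE : word_graph w = E.
  apply/setP => [[x y]]; apply/imsetP/idP => [[p _ ->]|xyE].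
    case: (boolP (p < #|L|)) => pL.
      by rewrite Dlo //; have := eL _ pL; rewrite inE => /andP[].
    rewrite Dhi //; have := eL (flip p); rewrite half inE => /(_ pL)/andP[+ _].
    by rewrite sym; case: (nth _ _ _).
  have get (a b : 'I_n) : a < b -> (a, b) \in E -> exists2 p : P, p < #|L| & nth x0 e p = (a, b).
    move=> ab abE; have abL : (a, b) \in e by rewrite mem_enum inE abE.
    have iL : index (a, b) e < #|L| by rewrite -se index_mem.
    have iP : index (a, b) e < d * n by rewrite -cardL -addnn (leq_trans iL) ?leq_addr.
    by exists (Ordinal iP); rewrite //= nth_index.
  have [xy|yx|xy] := ltngtP x y.
  - have [p pL pe] := get _ _ xy xyE; exists p => //; by rewrite Dlo.
  - rewrite sym in xyE; have [p pL pe] := get _ _ yx xyE; exists (flip p) => //.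
    by rewrite Dhi ?half ?pL // flipK pe.
  - by have := irr x; rewrite {2}(val_inj xy) xyE.
by exists w => //; apply: regular_simple_word reg inj wE.
Qed.

(** [flip_perms] acts simply transitively on the simple words of [G]: two such words list the same
    darts without repetition, so exactly one permutation matches them, and it commutes with
    [flip]. *)
Lemma card_fiber_graph (G : regular_graph d n) :
  #|[set w in simple_words 'I_n flip d | word_graph w == val G]%SET| = #|flip_perms|.
Proof.
have [w0 /simple_wordsP[w0W inj0] w0G] := exists_simple_word (valP G).
rewrite -(card_in_imset (D := mem flip_perms) (f := permw w0)).
  apply: eq_card => w; rewrite [in LHS]inE.
  apply/andP/imsetP => [[/simple_wordsP[wW inj] /eqP wG]|[s]].
    (* The permutation sends p to the position where [w0] carries the dart that [w] carries at p. *)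
    have ex p : exists r, dart flip w0 r = dart flip w p.
      have : dart flip w p \in word_graph w0 by rewrite w0G -wG; apply/imsetP; exists p.
      by move=> /imsetP[r _ ->]; exists r.
    have [f fE] := fin_all_exists ex.
    have f_inj : injective f by move=> p q e; apply: inj; rewrite -!fE e.
    exists (perm f_inj); last by apply/ffunP => p; rewrite ffunE permE; case: (fE p).
    rewrite inE; apply/forallP => p; rewrite !permE; apply/eqP/inj0.
    by rewrite fE !dart_flip // fE.
  rewrite inE => /forallP sflip ->.
  have D p : dart flip (permw w0 s) p = dart flip w0 (s p).
    by rewrite /dart !ffunE (eqP (sflip p)).
  have wG : word_graph (permw w0 s) = val G.
    rewrite -w0G; apply/setP => xy; apply/imsetP/imsetP => -[p _ ->].
      by exists (s p); rewrite ?D.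
    by exists (s^-1 p)%g; rewrite // D permKV.
  rewrite wG eqxx; split => //; apply: (regular_simple_word (valP G)) => // p q.
  by rewrite !D => /inj0 /perm_inj.
move=> s t; rewrite !inE => /forallP hs /forallP ht /ffunP e; apply/permP => p.
apply: inj0; rewrite /dart -(eqP (hs p)) -(eqP (ht p)).
by have := e p; have := e (flip p); rewrite !ffunE => -> ->.
Qed.

Lemma card_graph_words (A : {set regular_graph d n}) :
  #|[set w in simple_words 'I_n flip d | [exists G in A, word_graph w == val G]]%SET| =
  #|A| * #|flip_perms|.
Proof.
rewrite -sum_nat_const.
under [RHS]eq_bigr => G _ do rewrite -(card_fiber_graph G) -sum1_card.
rewrite [RHS](exchange_big_dep (mem [set w in simple_words 'I_n flip d |
  [exists G in A, word_graph w == val G]]%SET)) /=.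
  rewrite -sum1_card; apply: eq_bigr => w; rewrite inE => /andP[wS /exists_inP[G GA /eqP e]].
  rewrite (big_pred1 G) // => H; rewrite inE wS /= e.
  have [->|HG] := eqVneq H G; first by rewrite GA eqxx.
  by apply/negbTE; apply: contraNN HG => /andP[_ /eqP/val_inj ->].
by move=> G w GA; rewrite !inE => /andP[-> wG] /=; apply/exists_inP; exists G.
Qed.

Lemma card_simple_words :
  #|simple_words 'I_n flip d| = #|{: regular_graph d n}| * #|flip_perms|.
Proof.
rewrite -cardsT -card_graph_words; apply: eq_card => w; rewrite [in RHS]inE.
case: (boolP (w \in _)) => //= wS; apply/esym/exists_inP.
by exists (exist _ (word_graph w) (word_graph_regular wS)); rewrite ?inE.
Qed.

End WordGraphs.

(** * Type classes *)

Section ColorClasses.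
Local Open Scope nat_scope.
Variables (P S : finType).

Definition type_class (t : S -> nat) : {set {ffun P -> S}} :=
  [set c : {ffun P -> S} | [forall a, #|[set p | c p == a]%SET| == t a]]%SET.

Lemma type_classP (t : S -> nat) (c : {ffun P -> S}) :
  reflect (forall a, #|[set p | c p == a]%SET| = t a) (c \in type_class t).
Proof. by rewrite inE; apply: (iffP forallP) => h a; apply/eqP. Qed.

Lemma type_class_perm (t : S -> nat) (c1 c2 : {ffun P -> S}) :
  c1 \in type_class t -> c2 \in type_class t -> exists s, c2 = permw c1 s.
Proof.
move=> /type_classP h1 /type_classP h2.
have cnt (c : {ffun P -> S}) a : count_mem a (codom c) = #|[set p | c p == a]%SET|.
  rewrite /codom /image_mem count_map enumT cardE [in RHS]/enum_mem size_filter.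
  by apply: eq_count => p; rewrite /= !inE.
have : perm_eq (codom_tuple c2) (codom_tuple c1).
  by apply/allP => a _ /=; rewrite !cnt h1 h2.
move=> /tuple_permP [s /= e].
have inj : injective (fun p => enum_val (s (enum_rank p))).
  by move=> p q /enum_val_inj /perm_inj /enum_rank_inj.
exists (perm inj); apply/ffunP => p; rewrite ffunE permE.
have := congr1 (fun l => nth (c2 p) l (enum_rank p)) e.
rewrite nth_codom enum_rankK => ->.
rewrite (nth_map (enum_rank p)) ?size_enum_ord // nth_ord_enum.
by rewrite /tnth /= nth_codom.
Qed.

Variables (V : finType) (d : nat) (f : {ffun V -> S}).
Let W := words P V d.

Definition color_word (w : {ffun P -> V}) : {ffun P -> S} := [ffun p => f (w p)].

Lemma color_word_type w : w \in W ->
  color_word w \in type_class (fun a => d * #|[set v | f v == a]%SET|).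
Proof.
move=> wW; apply/type_classP => a.
rewrite -(card_words_fiber [set v | f v == a]%SET wW).
by apply: eq_card => p; rewrite !inE ffunE.
Qed.

(** Permutations of positions preserve [W], commute with [color_word] and are transitive on the type
    class, so the fibres over its members are equal in size. Colour words outside the type class
    have empty fibres, whence only an inequality for arbitrary [C]. *)
Lemma card_color_words (C : {set {ffun P -> S}}) :
  #|[set w in W | color_word w \in C]%SET| *
    #|type_class (fun a => d * #|[set v | f v == a]%SET|)| <= #|C| * #|W|.
Proof.
set T := type_class _.
have fib c : #|[set w in W | color_word w == c]%SET| * #|T| <= #|W|.
  have [->|] := eqVneq [set w in W | color_word w == c]%SET finset.set0.
    by rewrite cards0.
  case/set0Pn => w0 /setIdP[w0W /eqP w0c].
  have cT : c \in T by rewrite -w0c color_word_type.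
  have fibT c' : c' \in T ->
     #|[set w in W | color_word w == c]%SET| <= #|[set w in W | color_word w == c']%SET|.
    move=> /(type_class_perm cT)[s ->].
    rewrite -(card_imset (mem [set w in W | color_word w == c]%SET)
      (f := fun w : {ffun P -> V} => permw w s)); last first.
      move=> w1 w2 /ffunP e; apply/ffunP => x.
      by have := e ((s^-1)%g x); rewrite !ffunE permKV.
    apply: subset_leq_card; apply/fintype.subsetP => _ /imsetP[w /setIdP[wW /eqP <-] ->].
    apply/setIdP; split; first by rewrite permw_words.
    by apply/eqP/ffunP => p; rewrite !ffunE.
  rewrite mulnC -sum_nat_const.
  apply: (@leq_trans (\sum_(c' in T) #|[set w in W | color_word w == c']%SET|)).
    exact: leq_sum.
  rewrite -[X in _ <= X]sum1_card (partition_big color_word (mem T)) /=; last first.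
    exact: color_word_type.
  apply: leq_sum => c' _; rewrite -sum1_card; apply: eq_leq.
  by apply: eq_bigl => w; rewrite inE.
rewrite -sum1_card (partition_big color_word (mem C)) /=; last first.
  by move=> w /setIdP[].
rewrite big_distrl /= -sum_nat_const; apply: leq_sum => c cC.
apply: leq_trans (fib c); rewrite leq_mul2r -sum1_card; apply/orP; right.
apply: eq_leq; apply: eq_bigl => w; rewrite !inE -andbA; congr (_ && _).
by case: eqP => [->|]; rewrite ?cC ?andbF.
Qed.

End ColorClasses.

Section Multinomial.
Local Open Scope nat_scope.
Variable S : finType.

(* Induction on [N]: the words starting with [a] are counted by the tuple in
   which [t a] is decreased by one. *)
Lemma card_type_class N (t : S -> nat) : \sum_a t a = N ->
  N`! <= #|type_class 'I_N t| * \prod_a (t a)`!.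
Proof.
elim: N t => [|N IH] t sumt.
  have t0 a : t a = 0.
    by apply/eqP; have /eqP := sumt; rewrite sum_nat_eq0 => /forallP/(_ a).
  rewrite big1 => [|a _]; last by rewrite t0.
  rewrite muln1 card_gt0; apply/set0Pn.
  exists [ffun i : 'I_0 => let: Ordinal _ lt := i in False_rect S (notF lt)].
  apply/type_classP => a; rewrite t0; apply/eqP; rewrite cards_eq0.
  by apply/eqP/setP => -[].
pose t' a b := t b - (b == a).
have sub a : 0 < t a -> #|type_class 'I_N (t' a)| <=
   #|[set c in type_class 'I_N.+1 t | c ord0 == a]%SET|.
  move=> ta.
  pose ext (c : {ffun 'I_N -> S}) : {ffun 'I_N.+1 -> S} :=
    [ffun i => if unlift ord0 i is Some j then c j else a].
  have ext0 c : ext c ord0 = a by rewrite ffunE unlift_none.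
  have extS c j : ext c (lift ord0 j) = c j by rewrite ffunE liftK.
  rewrite -(card_imset (mem (type_class 'I_N (t' a))) (f := ext)); last first.
    by move=> c1 c2 e; apply/ffunP => j; rewrite -!extS e.
  apply: subset_leq_card; apply/fintype.subsetP => _ /imsetP[c /type_classP cT ->].
  apply/setIdP; split; last by rewrite ext0.
  apply/type_classP => b.
  transitivity ((a == b) + t' a b); last first.
    by rewrite /t' eq_sym; case: eqP => [->|_] /=; rewrite ?subn0 // subnKC.
  rewrite -cT -!sum1_card !big_mkcond /= big_ord_recl inE ext0.
  congr (_ + _).
  rewrite [RHS]big_mkcond /=.
  by apply: eq_bigr => j _; rewrite !inE extS.
rewrite -[X in _ <= X * _]sum1_card.
rewrite (partition_big (fun c : {ffun 'I_N.+1 -> S} => c ord0) predT) //=.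
rewrite big_distrl /= factS -[X in X * _ <= _]sumt big_distrl /=.
apply: leq_sum => a _.
case: (posnP (t a)) => [->//|ta].
apply: (@leq_trans (#|type_class 'I_N (t' a)| * \prod_b (t b)`!)); last first.
  rewrite leq_mul2r; apply/orP; right; apply: leq_trans (sub a ta) _.
  by rewrite -sum1_card; apply: eq_leq; apply: eq_bigl => c; rewrite !inE.
have sumt' : \sum_b t' a b = N.
  rewrite (bigD1 a) //= (eq_bigr t) => [|b /negPf ba]; last by rewrite /t' ba subn0.
  move: sumt; rewrite (bigD1 a) //= /t' eqxx.
  by move: (bigop _ _ _) => x; lia.
apply: leq_trans (_ : t a * (#|type_class 'I_N (t' a)| * \prod_b (t' a b)`!) <= _).
  by rewrite leq_mul2l IH ?orbT.
rewrite (bigD1 a) //= [X in _ <= _ * X](bigD1 a) //= /t' eqxx.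
rewrite (eq_bigr (fun b => (t b)`!)) => [|b /negPf->]; last by rewrite subn0.
rewrite -[in X in _ <= X](prednK ta) factS (prednK ta) -subn1.
move: (#|_|) (bigop _ _ _) (t a) ((t a - 1)`!) => x y z u.
by apply: eq_leq; ring.
Qed.

End Multinomial.

(** * Stirling bounds and entropy bounds for sets of words *)

Section EntropyBounds.
Variable R : realType.
Implicit Types (n N : nat).

Let L (k : nat) : R := k%:R * ln k%:R.

Lemma ln_succ_sub n : ln n.+2%:R - ln n.+1%:R <= n.+1%:R^-1 :> R.
Proof.
rewrite -ln_div ?posrE ?ltr0n //.
have -> : n.+2%:R / n.+1%:R = 1 + n.+1%:R^-1 :> R.
  by rewrite -[n.+2]addn1 natrD mulrDl divff ?pnatr_eq0 // mul1r.
by apply: le_ln1Dx; rewrite (lt_le_trans (ltrN10 _)) // invr_ge0 ler0n.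
Qed.

Lemma ln_succ_sub_ge n : n.+2%:R^-1 <= ln n.+2%:R - ln n.+1%:R :> R.
Proof.
rewrite -[X in _ <= X]opprB -ln_div ?posrE ?ltr0n // lerNr.
have -> : n.+1%:R / n.+2%:R = 1 + - n.+2%:R^-1 :> R.
  by rewrite -[n.+2%:R]natr1; field; rewrite nat1r natr1 pnatr_eq0.
by apply: le_ln1Dx; rewrite ltrN2 invf_lt1 ?ltr0n // ltr1n.
Qed.

(** n! >= (n/e)^n by induction, since n (ln (n+1) - ln n) <= 1. *)
Lemma ln_fact_ge n : L n - n%:R <= ln n`!%:R.
Proof.
elim: n => [|[|n] IH]; rewrite /L ?fact0 ?mul0r ?ln1 ?subr0 //.
rewrite factS natrM lnM ?posrE ?ltr0n ?fact_gt0 //.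
have := ln_succ_sub n; rewrite -(ler_pM2l (x := n.+1%:R)) ?ltr0n // mulfV ?pnatr_eq0 // => h.
move: IH h; rewrite /L; set a := ln n.+2%:R; set b := ln n.+1%:R; set c := ln _.
rewrite -[n.+2%:R]natr1; lra.
Qed.

(** The inductive step falls short by 1/(n+1), and the increment 2 (ln (n+2) - ln (n+1)) >= 2/(n+2)
    of the error term covers this; hence the coefficient 2. *)
Lemma ln_fact_le n : ln n`!%:R <= L n - n%:R + 2 * ln n.+1%:R.
Proof.
elim: n => [|[|n] IH]; rewrite /L ?fact0 ?mul0r ?ln1 ?subr0 ?mulr0 ?addr0 //.
  have := ln_succ_sub_ge 0; rewrite ln1 ; set u := ln _; move=> h {IH}; rewrite sub0r; lra.
rewrite factS natrM lnM ?posrE ?ltr0n ?fact_gt0 //.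
have h1 := ln_succ_sub_ge n; have h2 := ln_succ_sub_ge n.+1.
have {}h1 : 1 - n.+2%:R^-1 <= n.+1%:R * (ln n.+2%:R - ln n.+1%:R) :> R.
  apply: le_trans (ler_wpM2l (ler0n _ _) h1).
  rewrite le_eqVlt; apply/orP; left; apply/eqP.
  by rewrite -[n.+2%:R]natr1; field; rewrite nat1r natr1 pnatr_eq0.
have h3 : n.+2%:R^-1 <= 2 * n.+3%:R^-1 :> R.
  rewrite -[_^-1]mul1r ler_pdivrMr ?ltr0n // mulrAC ler_pdivlMr ?ltr0n //.
  by rewrite mul1r -natrM ler_nat; lia.
have arith (a b c e x y r s : R) : y = x + 1 -> c <= x * b - x + 2 * a ->
  1 - r <= x * (a - b) -> s <= e - a -> r <= 2 * s -> a + c <= y * a - y + 2 * e.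
  by move=> ->; lra.
by apply: (arith) IH h1 h2 h3; rewrite natr1.
Qed.

(** Stirling for the multinomial coefficient: the linear terms cancel because the [t a] sum to [N],
    and each factorial in the denominator costs at most 2 ln (N+1). *)
Lemma ln_type_class_ge (S : finType) N (t : S -> nat) : (\sum_a t a = N)%N ->
  L N - \sum_a L (t a) - (2 * #|S|)%:R * ln N.+1%:R <= ln #|type_class 'I_N t|%:R.
Proof.
move=> sumt.
have h := card_type_class sumt.
have T0 : (0 < #|type_class 'I_N t|)%N.
  by case: (#|_|) h => //; rewrite mul0n leqNgt fact_gt0.
have P0 : (0 < \prod_a (t a)`!)%N by apply: prodn_gt0 => a; rewrite fact_gt0.
have {}h : ln N`!%:R <= ln #|type_class 'I_N t|%:R + \sum_a ln (t a)`!%:R :> R.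
  have -> : \sum_a ln (t a)`!%:R = ln (\prod_a (t a)`!)%:R :> R.
    rewrite natr_prod.
    suff : ln (\prod_a (t a)`!%:R) = \sum_a ln (t a)`!%:R :> R /\
        0 < \prod_a (t a)`!%:R :> R by case.
    apply: (big_rec2 (fun (x y : R) => ln x = y /\ 0 < x)); first by rewrite ln1.
    move=> a x y _ [<- x0]; rewrite lnM ?posrE ?ltr0n ?fact_gt0 //.
    by rewrite mulr_gt0 ?ltr0n ?fact_gt0.
  rewrite -lnM ?posrE ?ltr0n // -natrM ler_ln ?posrE ?ltr0n ?ler_nat ?fact_gt0 //.
  by rewrite muln_gt0 T0 P0.
have h2 : \sum_a ln (t a)`!%:R <= \sum_a L (t a) - N%:R + (2 * #|S|)%:R * ln N.+1%:R.
  apply: (le_trans (ler_sum _ (fun a _ => ln_fact_le (t a)))).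
  rewrite !big_split /= sumrN -natr_sum sumt lerD2l.
  rewrite mulnC natrM -mulrA mulr_natl -sumr_const; apply: ler_sum => a _.
  rewrite ler_pM2l ?ltr0n // ler_ln ?posrE ?ltr0n // ler_nat ltnS.
  by rewrite -sumt (bigD1 a) //= leq_addr.
have := ln_fact_ge N; move: h h2.
by move: (ln _) (ln _) (bigop _ _ _) (bigop _ _ _) (_ * _) => a b c e f; rewrite /L; lra.
Qed.

(** The products of the [q i] form a subprobability on all words, so at most 1/x words can have
    weight at least x. Entropy upper bounds obtained this way lose no polynomial factor. *)
Lemma card_weight_le (I K : finType) (q : I -> K -> R) (C : {set {ffun I -> K}}) (x : R) :
  (forall i k, 0 <= q i k) -> (forall i, \sum_k q i k <= 1) ->
  (forall c, c \in C -> x <= \prod_i q i (c i)) -> #|C|%:R * x <= 1.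
Proof.
move=> q0 q1 qC.
apply: (@le_trans _ _ (\sum_(c in C) \prod_i q i (c i))).
  by rewrite mulr_natl -sumr_const; apply: ler_sum.
apply: (@le_trans _ _ (\sum_(c : {ffun I -> K}) \prod_i q i (c i))).
  rewrite [X in _ <= X](bigID (mem C)) /= lerDl; apply: sumr_ge0 => c _.
  exact: prodr_ge0.
rewrite -bigA_distr_bigA /=; apply: prodr_ile1 => i _.
by rewrite q1 andbT; apply: sumr_ge0.
Qed.

Lemma prod_freq (I K : finType) (c : I -> K) (r : K -> R) :
  (forall i, 0 < r (c i)) ->
  \prod_i r (c i) = expR (\sum_k #|[set i | c i == k]%SET|%:R * ln (r k)).
Proof.
move=> r0.
transitivity (expR (\sum_i ln (r (c i)))).
  by rewrite expR_sum; apply: eq_bigr => i _; rewrite lnK ?posrE.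
congr expR; rewrite (partition_big c predT) //=; apply: eq_bigr => k _.
rewrite mulr_natl -sumr_const; apply: eq_big => [i|i /eqP-> //].
by rewrite inE.
Qed.

Lemma ln_freq (K : finType) (m : K -> nat) N : (\sum_k m k = N)%N -> (0 < N)%N ->
  \sum_k (m k)%:R * ln ((m k)%:R / N%:R) = - (L N - \sum_k L (m k)).
Proof.
move=> mN N0; rewrite opprB /L -[X in _ - X%:R * _]mN natr_sum mulr_suml -sumrB.
apply: eq_bigr => k _; have [->|mk] := posnP (m k); first by rewrite !mul0r subr0.
by rewrite ln_div ?posrE ?ltr0n // mulrBr.
Qed.

(** The weight is the i.i.d. law with the letter frequencies of the class itself; every member has
    weight exp of minus the exponent. *)
Lemma ln_card_type_class_le (V S : finType) (t : S -> nat) :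
  (0 < #|V|)%N -> (\sum_a t a = #|V|)%N ->
  #|type_class V t|%:R <= expR (L #|V| - \sum_a L (t a)).
Proof.
move=> V0 tV; rewrite -[expR _]invrK -expRN -[_^-1]mul1r ler_pdivlMr ?expR_gt0 //.
apply: (card_weight_le (q := fun _ a => (t a)%:R / #|V|%:R)).
- by move=> _ a; rewrite divr_ge0 ?ler0n.
- by move=> _; rewrite -mulr_suml -natr_sum tV divff // pnatr_eq0 -lt0n.
- move=> c /type_classP cT.
  rewrite (prod_freq (c := fun v => c v) (r := fun a => (t a)%:R / #|V|%:R)) => [|v].
    rewrite -ln_freq // ler_expR; apply: ler_sum => a _; by rewrite cT.
  rewrite divr_gt0 ?ltr0n // -cT; apply/card_gt0P; exists v; by rewrite inE.
Qed.

Lemma entropy_freq (K : finType) (m : K -> nat) N : (\sum_k m k = N)%N -> (0 < N)%N ->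
  N%:R * entropy (fun k => (m k)%:R / N%:R) = L N - \sum_k L (m k).
Proof.
move=> mN N0; rewrite -[RHS]opprK -ln_freq // /entropy mulrN mulr_sumr; congr (- _).
apply: eq_bigr => k _; rewrite mulrA; congr (_ * _).
by rewrite mulrCA divff ?mulr1 // pnatr_eq0 -lt0n.
Qed.

End EntropyBounds.

(** * Colour words with prescribed frequencies on paired positions *)

Section EdgeWords.
Variables (R : realType) (S : finType) (N : nat).
Hypothesis N_even : ~~ odd N.
Let flip := @rev_ord N.
Let L (k : nat) : R := k%:R * ln k%:R.

Definition edge_freq (c : {ffun 'I_N -> S}) (ab : S * S) : nat :=
  #|[set p | (c p, c (flip p)) == ab]%SET|.

Lemma edge_freq_sym c a b : edge_freq c (a, b) = edge_freq c (b, a).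
Proof.
rewrite /edge_freq -(card_imset _ (@rev_ord_inj N)); apply: eq_card => p.
apply/imsetP/idP => [[q + ->]|h].
  by rewrite !inE /flip rev_ordK !xpair_eqE andbC.
by exists (flip p); rewrite /flip ?rev_ordK // inE rev_ordK; move: h; rewrite inE !xpair_eqE andbC.
Qed.

Lemma sum_edge_freq c : (\sum_ab edge_freq c ab = N)%N.
Proof.
rewrite -[RHS]card_ord -sum1_card (partition_big (fun p => (c p, c (flip p))) predT) //=.
by apply: eq_bigr => ab _; rewrite /edge_freq -sum1_card; apply: eq_bigl => p; rewrite inE.
Qed.

(* One position per edge carries the factor [q], so that the squared weight of a
   word is the product of [q] over all darts. *)
Lemma card_edge_words_le (e : S * S -> nat) (C : {set {ffun 'I_N -> S}}) : (0 < N)%N ->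
  (forall c, c \in C -> edge_freq c =1 e) ->
  #|C|%:R <= expR (2^-1 * (L N - \sum_ab L (e ab))).
Proof.
move=> N0 Ce.
(* A member of [C] is needed to know that [e] is symmetric and sums to [N]. *)
have [->|[c0 c0C]] := set_0Vmem C; first by rewrite cards0 expR_ge0.
have esum : (\sum_ab e ab = N)%N.
  by rewrite -[RHS](sum_edge_freq c0); apply: eq_bigr => ab _; rewrite Ce.
have esym a b : e (a, b) = e (b, a) by rewrite -!(Ce _ c0C) edge_freq_sym.
pose q ab : R := (e ab)%:R / N%:R.
have q0 ab : 0 <= q ab by rewrite divr_ge0 ?ler0n.
have q1 : \sum_ab q ab = 1 by rewrite -mulr_suml -natr_sum esum divff // pnatr_eq0 -lt0n.
pose lo (p : 'I_N) := (p < flip p)%N.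
have hilo p : ~~ lo p = lo (flip p).
  rewrite /lo /flip rev_ordK -leqNgt leq_eqVlt.
  suff -> : (rev_ord p == p :> nat) = false by [].
  apply/negbTE/eqP => /= h; move: N_even.
  have -> : N = p.*2.+1 by have := ltn_ord p; lia.
  by rewrite /= odd_double.
(* The upper position of each edge gets this filler with weight 1; its colour is still recorded at
   the lower position, so [g] stays injective. *)
pose x0 := (c0 (Ordinal N0), c0 (Ordinal N0)).
pose g (c : {ffun 'I_N -> S}) : {ffun 'I_N -> S * S} :=
  [ffun p => if lo p then (c p, c (flip p)) else x0].
have ginj : injective g.
  move=> c1 c2 /ffunP h; apply/ffunP => p; case: (boolP (lo p)) => lp.
    by have := h p; rewrite !ffunE lp => -[].
  by have := h (flip p); rewrite !ffunE -hilo lp !(rev_ordK p : flip (flip p) = p) => -[].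
rewrite -(card_imset (mem C) ginj) -[expR _]invrK -expRN -[_^-1]mul1r ler_pdivlMr ?expR_gt0 //.
apply: (card_weight_le (q := fun p ab => if lo p then q ab else (ab == x0)%:R)).
- by move=> p ab; case: ifP => _; rewrite ?q0 ?ler0n.
- move=> p; case: (lo p); first by rewrite q1.
  by rewrite (bigD1 x0) //= eqxx big1 ?addr0 // => ab /negPf->.
move=> _ /imsetP[c cC ->].
have cpos p : 0 < q (c p, c (flip p)).
  rewrite /q divr_gt0 ?ltr0n // -(Ce _ cC) /edge_freq; apply/card_gt0P.
  by exists p; rewrite inE.
set X := \prod_p _.
have XE : X = \prod_(p | lo p) q (c p, c (flip p)).
  rewrite [RHS]big_mkcond; apply: eq_bigr => p _; rewrite ffunE.
  by case: (lo p); rewrite ?eqxx.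
have X0 : 0 <= X by rewrite XE; apply: prodr_ge0.
rewrite -(ler_pXn2r (n := 2)) ?nnegrE ?expR_ge0 //.
rewrite -expRM_natl mulrN mulrA mulfV ?pnatr_eq0 // mul1r.
rewrite -(ln_freq R esum N0).
(* The second copy of the product is moved to the upper positions by [flip]; the symmetry of [e]
   makes the factors agree. *)
have -> : X ^+ 2 = \prod_p q (c p, c (flip p)).
  rewrite expr2 (bigID lo) /= -XE; congr (_ * _).
  rewrite (reindex_inj (@rev_ord_inj N)) /= XE; apply: eq_big => p.
    by rewrite -/(flip p) -hilo negbK.
  by move=> _; rewrite /flip rev_ordK /q esym.
rewrite (prod_freq (c := fun p => (c p, c (flip p))) (r := q)) // ler_expR.
by apply: ler_sum => ab _; rewrite /q -(Ce _ cC).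
Qed.

End EdgeWords.

(** * First moment bound *)

Section Counting.
Variables (R : realType) (S : finType) (d n : nat).
Hypothesis dn_even : ~~ odd (d * n).
Hypothesis d_gt0 : (0 < d)%N.
Hypothesis n_gt0 : (0 < n)%N.
Let N := (d * n)%N.
Let flip := @rev_ord N.
Let W := words 'I_N 'I_n d.
Let bad_bound := (2 * (2 * d + 4 * d ^ 2))%N.
Hypothesis N_big : (6 + d * (d + 2) + d * (d + 1) + bad_bound < N)%N.

Definition graph_edge_freq (G : regular_graph d n) (f : {ffun 'I_n -> S}) (ab : S * S) : nat :=
  #|[set xy in val G | (f xy.1, f xy.2) == ab]%SET|.

Lemma edge_freq_word (w : {ffun 'I_N -> 'I_n}) (G : regular_graph d n) f :
  w \in simple_words 'I_n flip d -> word_graph w = val G ->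
  edge_freq (color_word f w) =1 graph_edge_freq G f.
Proof.
move=> /simple_wordsP[_ inj] wG ab; rewrite /graph_edge_freq -wG.
rewrite /edge_freq -(card_imset _ inj); apply: eq_card => xy; rewrite inE.
apply/imsetP/andP => [[p + ->]|[/imsetP[p _ ->] h]].
  by rewrite inE !ffunE => h; split => //; apply/imsetP; exists p.
by exists p; rewrite ?inE ?ffunE.
Qed.

Lemma row_edge_freq (w : {ffun 'I_N -> 'I_n}) (f : {ffun 'I_n -> S}) a : w \in W ->
  (\sum_b edge_freq (color_word f w) (a, b) = d * #|[set v | f v == a]%SET|)%N.
Proof.
move=> wW; have /type_classP/(_ a) <- := color_word_type f wW.
rewrite -sum1_card (partition_big (fun p => color_word f w (flip p)) predT) //=.
apply: eq_bigr => b _; rewrite /edge_freq -sum1_card; apply: eq_bigl => p.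
by rewrite !inE xpair_eqE.
Qed.

(** Double counting of pairs (colouring, word) with edge frequencies [e]. In the polynomial factor,
    4 N^(2 [bad_bound]) compares all words with the simple words of graphs in [A], (N+1)^(#|S|^2) is
    the number of candidates for [e], and (N+1)^(2 #|S|) is the Stirling loss. *)
Lemma edge_freq_counting (A : {set regular_graph d n}) (Good : {set {ffun S * S -> 'I_N.+1}}) :
  (forall G, G \in A -> exists f : {ffun 'I_n -> S}, exists2 e : {ffun S * S -> 'I_N.+1},
     e \in Good & forall ab, graph_edge_freq G f ab = e ab) ->
  (#|{: regular_graph d n}| < 2 * #|A|)%N ->
  exists e : {ffun S * S -> 'I_N.+1}, [/\ e \in Good, (\sum_ab e ab = N)%N &
    1 <= (4 * N ^ (2 * bad_bound) * N.+1 ^ (#|S| * #|S| + 2 * #|S|))%:R *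
      expR (n%:R * (d%:R / 2 * entropy (fun ab => (e ab)%:R / N%:R)
        - (d%:R - 1) * entropy (fun a => (\sum_b (e (a, b)))%:R / N%:R))) :> R].
Proof.
move=> AGood Abig.
pose E := {ffun S * S -> 'I_N.+1}.
pose X (e : E) := [set fw : {ffun 'I_n -> S} * {ffun 'I_N -> 'I_n} |
  (fw.2 \in W) && [forall ab, edge_freq (color_word fw.1 fw.2) ab == e ab]]%SET.
pose m := (#|A| * #|flip_perms n d|)%N.
have G0 : (0 < #|flip_perms n d|)%N.
  apply/card_gt0P; exists 1%g; rewrite inE; apply/forallP => p.
  by rewrite !perm1.
have m0 : (0 < m)%N by rewrite muln_gt0 G0 andbT; case: (#|A|) Abig.
(* One factor 2 comes from [card_words_le], the other from [A] being more than half of the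
   graphs. *)
have Wm : (#|W| <= 4 * N ^ (2 * bad_bound) * m)%N.
  have := card_words_le 'I_n (@rev_ordK N) (rev_ord_neq dn_even) (d := d).
  rewrite card_ord => /(_ N_big) h; apply: (leq_trans h).
  rewrite card_simple_words // -/bad_bound.
  rewrite /m; move: (_ ^ _)%N #|flip_perms n d| #|{: regular_graph d n}| #|A| Abig => a x g b gb.
  have -> : (4 * a * (b * x) = 2 * a * (2 * b * x))%N by ring.
  by rewrite leq_mul2l leq_mul2r (ltnW gb) !orbT.
have mX : (m <= \sum_(e in Good) #|X e|)%N.
  rewrite /m -card_graph_words //.
  apply: (@leq_trans #|\bigcup_(e in Good) [set fw.2 | fw in X e]%SET|%SET).
    apply: subset_leq_card; apply/fintype.subsetP => w /setIdP[wS /exists_inP[G GA /eqP wG]].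
    have [f [e eG fe]] := AGood G GA.
    apply/finset.bigcupP; exists e => //; apply/imsetP; exists (f, w) => //.
    rewrite inE /=; have /simple_wordsP[-> _] := wS.
    by apply/forallP => ab; rewrite (edge_freq_word f wS wG) fe.
  apply: (big_ind2 (fun (B : {set _}) k => #|B| <= k)%N).
  - by rewrite cards0.
  - by move=> B1 k1 B2 k2 h1 h2; apply: leq_trans (leq_card_setU _ _) (leq_add h1 h2).
  - by move=> e _; apply: leq_imset_card.
(* Pigeonhole: some [e] accounts for at least the average share of the words of [A]. *)
have [e eG mXe] : exists2 e : E, e \in Good & (m <= #|{: E}| * #|X e|)%N.
  apply/exists_inP; apply: contraT; rewrite negb_exists_in => /forall_inP h.
  have E0 : (0 < #|{: E}|)%N by apply/card_gt0P; exists [ffun=> ord0].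
  have : (\sum_(e in Good) #|{: E}| * #|X e| <= #|{: E}| * m.-1)%N.
    apply: (@leq_trans (\sum_(e in Good) m.-1)%N).
      by apply: leq_sum => e /h; rewrite -ltnNge; case: (m) m0.
    by rewrite sum_nat_const leq_mul2r max_card orbT.
  rewrite -big_distrr /= leq_mul2l => /orP[/eqP T0|h2]; first by rewrite T0 in E0.
  by move: (leq_trans mX h2); case: (m) m0 => //= k _; rewrite ltnn.
have /card_gt0P[[f0 w0]] : (0 < #|X e|)%N.
  by case: (#|X e|) mXe => //; rewrite muln0 leqNgt m0.
rewrite inE /= => /andP[w0W /forallP/= e0].
have {}e0 ab : edge_freq (color_word f0 w0) ab = e ab by apply/eqP.
(* The row sums of [e] are [d * t a], so [e] determines the colour counts: every colouring occurring
   in [X e] lies in the type class of [t]. *)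
pose t a := #|[set v | f0 v == a]%SET|.
have dt a : (\sum_b e (a, b) = d * t a)%N.
  by rewrite -(row_edge_freq f0 a w0W); apply: eq_bigr => b _; rewrite e0.
have sumt : (\sum_a t a = #|'I_n|)%N.
  rewrite -sum1_card (partition_big f0 predT) //=; apply: eq_bigr => a _.
  by rewrite /t -sum1_card; apply: eq_bigl => v; rewrite inE.
have sumdt : (\sum_a d * t a = N)%N by rewrite -big_distrr /= sumt card_ord.
have sume : (\sum_ab e ab = N)%N.
  by rewrite -[RHS](sum_edge_freq (color_word f0 w0)); apply: eq_bigr => ab _.
have N0 : (0 < N)%N by rewrite muln_gt0 d_gt0.
exists e; split => //.
pose C := [set c : {ffun 'I_N -> S} | [forall ab, edge_freq c ab == e ab]]%SET.
pose T := type_class 'I_N (fun a => d * t a)%N.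
(* For each such colouring, the proportion of words whose colour word lies in [C] is at most #|C| /
   #|T|. *)
have XT : (#|X e| * #|T| <= #|type_class 'I_n t| * (#|C| * #|W|))%N.
  rewrite -sum1_card (partition_big fst (mem (type_class 'I_n t))) /=; last first.
    move=> [f w]; rewrite inE /= => /andP[wW /forallP/= ew]; apply/type_classP => a.
    apply/eqP; rewrite -(eqn_pmul2l d_gt0) -(row_edge_freq f a wW) -dt; apply/eqP.
    by apply: eq_bigr => b _; apply/eqP.
  rewrite big_distrl /= -sum_nat_const; apply: leq_sum => f /type_classP ft.
  have := card_color_words d f C.
  rewrite (_ : type_class _ _ = T); last first.
    by apply/setP => c; rewrite !inE; apply: eq_forallb => a; rewrite ft.
  apply: leq_trans; rewrite leq_mul2r; apply/orP; right.
  rewrite -(card_imset (mem [set w in W | color_word f w \in C]%SET) (f := pair f)).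
    2: by move=> ? ? [].
  rewrite -[X in (_ <= X)%N]sum1_card; apply: eq_leq; apply: eq_bigl => [[f' w]] /=.
  apply/andP/imsetP => [[/[!inE]/= /andP[wW ew] /eqP e2]|[w' /setIdP[wW ew] [-> ->]]].
    by exists w; rewrite -?e2 // !inE wW.
  rewrite eqxx; split=> //; rewrite inE /= (_ : w' \in W = true) //.
  by move: ew; rewrite inE.
have W0 : (0 < #|W|)%N by apply/card_gt0P; exists w0.
have key : (#|T| <= 4 * N ^ (2 * bad_bound) * #|{: E}| * #|type_class 'I_n t| * #|C|)%N.
  rewrite -(leq_pmul2r W0) mulnC.
  apply: (@leq_trans (4 * N ^ (2 * bad_bound) * #|{: E}| * (#|X e| * #|T|))%N).
    rewrite mulnA leq_mul2r; apply/orP; right; apply: (leq_trans Wm).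
    by rewrite -[X in (_ <= X)%N]mulnA leq_mul2l mXe orbT.
  by rewrite -[X in (_ <= X)%N]mulnA -[X in (_ <= X)%N]mulnA leq_mul2l XT orbT.
have EN : #|{: E}| = (N.+1 ^ (#|S| * #|S|))%N by rewrite card_ffun card_ord card_prod.
have hT := ln_type_class_ge R sumdt.
have T0 : (0 < #|T|)%N.
  by apply/card_gt0P; exists (color_word f0 w0); apply: color_word_type.
have hv : expR (N%:R * entropy (fun a => (\sum_b e (a, b))%:R / N%:R) -
     (2 * #|S|)%:R * ln N.+1%:R) <= #|T|%:R :> R.
  rewrite -[X in _ <= X](@lnK R) ?posrE ?ltr0n // ler_expR; apply: le_trans hT.
  rewrite (entropy_freq R (m := fun a => \sum_b e (a, b))%N) // => [|].
    by under eq_bigr do rewrite dt.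
  by under eq_bigr do rewrite dt.
have hn : #|type_class 'I_n t|%:R <=
    expR (n%:R * entropy (fun a => (\sum_b e (a, b))%:R / N%:R)) :> R.
  (* As N = d n, colour frequencies among the vertices and among the positions agree, so the same
     entropy governs [type_class 'I_n t] and [T]. *)
  have -> : (fun a => (\sum_b e (a, b))%:R / N%:R : R) = (fun a => (t a)%:R / n%:R).
    apply/funext => a; rewrite dt /N !natrM -mulf_div divff ?mul1r // pnatr_eq0 -lt0n //.
  rewrite entropy_freq //; last by rewrite sumt card_ord.
  have := @ln_card_type_class_le R 'I_n S t; rewrite !card_ord.
  by apply=> //; rewrite sumt card_ord.
have hC : #|C|%:R <= expR (2^-1 * (N%:R * entropy (fun ab => (e ab)%:R / N%:R))) :> R.
  rewrite entropy_freq //; apply: card_edge_words_le => // c.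
  by rewrite inE => /forallP h ab; apply/eqP.
set Hv := entropy _ in hv hn *; set He := entropy _ in hC *.
have : expR (N%:R * Hv - (2 * #|S|)%:R * ln N.+1%:R) <=
  (4 * N ^ (2 * bad_bound) * #|{: E}|)%:R * (expR (n%:R * Hv) * expR (2^-1 * (N%:R * He))).
  apply: (le_trans hv).
  apply: (@le_trans _ _ ((4 * N ^ (2 * bad_bound) * #|{: E}|)%:R *
    (#|type_class 'I_n t|%:R * #|C|%:R))).
    by rewrite -!natrM ler_nat mulnA; exact: key.
  by rewrite ler_wpM2l ?ler0n // ler_pM ?ler0n.
rewrite expRB (expRM_natl (2 * #|S|)) lnK ?posrE ?ltr0n // -natrX ler_pdivrMr ?ltr0n ?expn_gt0 //.
rewrite EN -expRD => h.
rewrite expnD mulnA natrM mulrAC.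
have -> : n%:R * (d%:R / 2 * He - (d%:R - 1) * Hv) = (n%:R * Hv + 2^-1 * (N%:R * He)) - N%:R * Hv.
  by rewrite /N natrM; field.
by rewrite expRB mulrA mulrAC ler_pdivlMr ?expR_gt0 ?mul1r.
Qed.

End Counting.

(** * Automorphisms of the tree *)

Section TreeAutomorphisms.
Variable d : nat.
Implicit Types (c : 'I_d) (x y z : tree d) (w : seq 'I_d).

(** Left multiplication by a generator of the free product, on reduced words; generators are
    involutions. *)
Definition letter_act c w : seq 'I_d :=
  if w is b :: w' then if c == b then w' else c :: w else [:: c].

Lemma letter_act_reduced c w : reduced w -> reduced (letter_act c w).
Proof.
case: w => [|b w] //= h; case: eqVneq => [_|cb]; first exact: path_sorted h.
by rewrite /reduced /= cb.
Qed.

Lemma letter_actK c w : reduced w -> letter_act c (letter_act c w) = w.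
Proof.
case: w => [|b w] /=; first by rewrite eqxx.
case: eqVneq => [->|cb] /=; last by rewrite eqxx.
case: w => [|b' w] //= /andP[bb' _]; by rewrite (negPf bb').
Qed.

Definition tree_act c x : tree d :=
  exist _ (letter_act c (val x)) (letter_act_reduced c (valP x)).

Lemma tree_actK c : involutive (tree_act c).
Proof. by move=> x; apply: val_inj; rewrite /= letter_actK ?(valP x). Qed.

Lemma tree_adjP x y : reflect (exists c, y = tree_act c x) (tree_adj x y).
Proof.
apply: (iffP orP) => [|[c ->]].
  case: x y => [x xr] [y yr] /= [] /existsP[c /eqP e]; exists c; apply: val_inj => /=.
    move: yr; rewrite e /reduced.
    by case: (x) => [|b w] //= /andP[/negPf->].
  by rewrite e /= eqxx.
case: x => [[|b w] xr] /=.
  by left; apply/existsP; exists c.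
case: (eqVneq c b) => [<-|cb]; last by left; apply/existsP; exists c.
by right; apply/existsP; exists c.
Qed.

(** The group product of y with x, that is, right multiplication by x. It commutes with left
    multiplication by letters, which defines adjacency, and is therefore an automorphism. *)
Definition translate x y : tree d := foldr tree_act x (val y).

Lemma translate_root x : translate x (tree_root d) = x. Proof. by []. Qed.

Lemma translate_act x c y : translate x (tree_act c y) = tree_act c (translate x y).
Proof.
rewrite /translate /=; case: (val y) => [|b w] //=.
by case: eqVneq => [->|_] //=; rewrite tree_actK.
Qed.

Lemma translateA x y z : translate x (translate y z) = translate (translate x y) z.
Proof.
change (translate x (foldr tree_act y (val z)) = foldr tree_act (translate x y) (val z)).
elim: (val z) => //= c w IH.
by rewrite translate_act IH.
Qed.

Lemma translate_id : translate (tree_root d) =1 id.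
Proof.
move=> y; apply: val_inj; rewrite /translate.
elim: (val y) (valP y) => //= c w IH cw; rewrite IH; last exact: path_sorted cw.
by case: w cw {IH} => [|b w] //= /andP[/negPf->].
Qed.

Lemma translate_linv x : exists y, translate y x = tree_root d.
Proof.
(* Writing x as its letters acting on the root permits induction on the bare word, without its proof
   of reducedness. *)
suff: exists y, translate y (translate (tree_root d) x) = tree_root d by rewrite translate_id.
change (exists y, translate y (foldr tree_act (tree_root d) (val x)) = tree_root d).
elim: (val x) => [|c w [y yw]] /=; first by exists (tree_root d).
exists (translate (tree_act c (tree_root d)) y).
by rewrite translate_act -translateA yw translate_root tree_actK.
Qed.

Lemma translate_aut x : tree_aut (translate x).
Proof.
have [y yx] := translate_linv x; have [z zy] := translate_linv y.
have yK : cancel (translate x) (translate y).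
  by move=> u; rewrite translateA yx translate_id.
have zK : cancel (translate y) (translate z).
  by move=> u; rewrite translateA zy translate_id.
have zx : translate z =1 translate x by move=> u; rewrite -{1}(yK u) zK.
have xK : cancel (translate y) (translate x) by move=> u; rewrite -zx zK.
split; first by exists (translate y).
move=> u v; apply/tree_adjP/tree_adjP => -[c e]; exists c.
  by rewrite -(yK v) e translate_act yK.
by rewrite e translate_act.
Qed.

Lemma reduced_map (s : {perm 'I_d}) w : reduced (map s w) = reduced w.
Proof.
case: w => // c w; rewrite /reduced /= path_map.
by apply: eq_path => a b; rewrite /= (inj_eq perm_inj).
Qed.

Lemma relabel_subproof (s : {perm 'I_d}) x : reduced (map s (val x)).
Proof. by rewrite reduced_map (valP x). Qed.

Definition relabel (s : {perm 'I_d}) x : tree d := exist _ (map s (val x)) (relabel_subproof s x).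

Lemma relabel_aut s : tree_aut (relabel s).
Proof.
have relK t : cancel (relabel t) (relabel t^-1%g).
  move=> x; apply: val_inj; rewrite /= -map_comp map_id_in // => c _ /=.
  by rewrite permK.
have rel_act t c x : relabel t (tree_act c x) = tree_act (t c) (relabel t x).
  apply: val_inj => /=; case: (val x) => //= b w.
  by rewrite (inj_eq perm_inj); case: eqP.
split; first by exists (relabel s^-1%g) => // x; rewrite -{1}(invgK s) relK.
move=> u v; apply/tree_adjP/tree_adjP => -[c e].
  by exists (s^-1%g c); rewrite -(relK s v) e rel_act relK.
by exists (s c); rewrite e rel_act.
Qed.

Lemma tree_aut_comp (g h : tree d -> tree d) : tree_aut g -> tree_aut h -> tree_aut (g \o h).
Proof.
by move=> [bg mg] [bh mh]; split; [exact: bij_comp|move=> x y; rewrite /= mg mh].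
Qed.

(** Translations preserve the letter of an edge; relabelling the letters fixes the root and first
    turns the letter c into that of the target edge. *)
Lemma tree_edge_transitive x y c : tree_adj x y -> exists g,
  [/\ tree_aut g, g (tree_root d) = x & g (tree_act c (tree_root d)) = y].
Proof.
move=> /tree_adjP[b ->]; exists (translate x \o relabel (tperm c b)); split.
- by apply: tree_aut_comp; [apply: translate_aut|apply: relabel_aut].
- have e : relabel (tperm c b) (tree_root d) = tree_root d by apply: val_inj.
  by rewrite /comp e translate_root.
- have e : relabel (tperm c b) (tree_act c (tree_root d)) = tree_act b (tree_root d).
    by apply: val_inj; rewrite /= tpermL.
  by rewrite /comp e translate_act translate_root.
Qed.

End TreeAutomorphisms.

(** * Local limits *)

Section TypicalProcesses.
Local Open Scope classical_set_scope.

Lemma measure_fin_union (R : realType) (disp : measure_display) (T : measurableType disp)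
    (mu : probability T R) (I : finType) (A : {set I}) (F : I -> set T) :
  (forall i, measurable (F i)) -> trivIset setT F ->
  mu (\bigcup_(i in [set` enum A]) F i) = \sum_(i in A) mu (F i).
Proof.
move=> mF tF; rewrite measure_fin_bigcup //=.
- by rewrite -fsbig_seq ?enum_uniq // big_enum.
- exact: sub_trivIset tF.
Qed.

(** * Vertex and edge marginals of an invariant process *)

Section ColoringLaws.
Variables (R : realType) (d : nat) (S : finPointedType).
Variable nu : probability (borel_coloring d S) R.

Lemma measurable_vertex_color (x : tree d) (a : S) :
  measurable [set w : borel_coloring d S | w x = a].
Proof.
apply: sub_sigma_algebra.
have cont : continuous ((fun w => w x) : coloring d S -> discrete_topology S).
  exact: (@proj_continuous (tree d) (fun=> discrete_topology S) x).
exact: (iffLR (continuousP _) cont [set a] (discrete_open _)).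
Qed.

Lemma measurable_edge_color (x y : tree d) (a b : S) :
  measurable [set w : borel_coloring d S | w x = a /\ w y = b].
Proof. exact: measurableI (measurable_vertex_color x a) (measurable_vertex_color y b). Qed.

Definition edge_law (c : 'I_d) (ab : S * S) : R :=
  fine (nu [set w : borel_coloring d S |
    w (tree_root d) = ab.1 /\ w (tree_act c (tree_root d)) = ab.2]).

Hypothesis nu_inv : invariant_process nu.

Lemma edge_law_edge c (x y : tree d) a b : tree_adj x y ->
  fine (nu [set w : borel_coloring d S | w x = a /\ w y = b]) = edge_law c (a, b).
Proof.
move=> /(tree_edge_transitive c) [g [gaut gx gy]].
have := nu_inv gaut (measurable_edge_color (tree_root d) (tree_act c (tree_root d)) a b).
by rewrite /= gx gy => ->.
Qed.

Lemma edge_law_const c c' : edge_law c = edge_law c'.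
Proof.
apply/funext => -[a b]; apply: edge_law_edge.
by apply/tree_adjP; exists c.
Qed.

Lemma h_edge_law c (x y : tree d) : tree_adj x y -> h_edge nu x y = entropy (edge_law c).
Proof.
move=> xy; rewrite /h_edge /entropy; congr (- _); apply: eq_bigr => -[a b] _ /=.
by rewrite (edge_law_edge c).
Qed.

Lemma sum_edge_law c a : \sum_b edge_law c (a, b) =
  fine (nu [set w : borel_coloring d S | w (tree_root d) = a]).
Proof.
rewrite /edge_law /=.
rewrite sum_fine => [|b _]; last exact: fin_num_measure (measurable_edge_color _ _ _ _).
congr fine; transitivity (\sum_(b in [set: S]%SET) nu [set w : borel_coloring d S |
    w (tree_root d) = a /\ w (tree_act c (tree_root d)) = b]).
  by apply: eq_bigl => b; rewrite inE.
rewrite -measure_fin_union.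
- congr (nu _); apply/seteqP; split => w /=; first by case=> b _ [].
  by move=> wa; exists (w (tree_act c (tree_root d))) => //=; rewrite mem_enum inE.
- by move=> b; apply: measurable_edge_color.
- apply/trivIsetP => b b' _ _ bb'; apply/seteqP; split => w //= [[_ e1] [_ e2]].
  by rewrite -e1 -e2 eqxx in bb'.
Qed.

Lemma h_vertex_law c (v : tree d) :
  h_vertex nu v = entropy (fun a => \sum_b edge_law c (a, b)).
Proof.
rewrite /h_vertex /entropy; congr (- _); apply: eq_bigr => a _.
rewrite sum_edge_law.
have := nu_inv (translate_aut v) (measurable_vertex_color (tree_root d) a).
by rewrite /= translate_root => ->.
Qed.

End ColoringLaws.

(** * Neighbour counts as isomorphism invariants of balls *)

Section NeighborCount.
Variables (S : eqType) (d : nat).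
Implicit Types (A B : rcgraph S) (a b : S).

(* The number of neighbours of the root with colour [b], truncated at [d], in a
   form that makes sense on an arbitrary vertex type. *)
Definition nbr_count b A : nat :=
  (\sum_(k < d) `[< exists g : 'I_k.+1 -> rc_vertex A, injective g /\
      forall j, rc_adj (rc_root A) (g j) /\ rc_color (g j) = b >])%N.

Lemma rc_iso_sym A B : rc_iso A B -> rc_iso B A.
Proof.
move=> [h [[h' hK h'K] h0 hadj hcol]]; exists h'; split.
- by exists h.
- by rewrite -h0 hK.
- by move=> x y; rewrite -hadj !h'K.
- by move=> x; rewrite -hcol h'K.
Qed.

Lemma nbr_count_iso b A B : rc_iso A B -> nbr_count b A = nbr_count b B.
Proof.
move=> AB; apply: eq_bigr => k _; congr nat_of_bool.
have sub A' B' : rc_iso A' B' ->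
  (exists g : 'I_k.+1 -> rc_vertex A', injective g /\
      forall j, rc_adj (rc_root A') (g j) /\ rc_color (g j) = b) ->
  (exists g : 'I_k.+1 -> rc_vertex B', injective g /\
      forall j, rc_adj (rc_root B') (g j) /\ rc_color (g j) = b).
  move=> [h [/bij_inj hinj h0 hadj hcol]] [g [ginj gP]]; exists (h \o g); split.
    exact: inj_comp.
  by move=> j /=; rewrite -h0 hadj hcol.
by apply/asboolP/asboolP; apply: sub => //; apply: rc_iso_sym.
Qed.

(** An injection from ['I_k.+1] exists exactly when the count exceeds k, so the d indicators add up
    to the count as long as it is at most d. Neighbours of the root survive in the ball of radius
    1. *)
Lemma nbr_count_ball (V : eqType) (e : rel V) (v : V) (f : V -> S) b (s : seq V) :
  uniq s -> (size s <= d)%N -> (forall u, (u \in s) = e v u && (f u == b)) ->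
  nbr_count b (rc_ball 1 (RCGraph e v f)) = size s.
Proof.
move=> us sd sP; rewrite /nbr_count.
transitivity (\sum_(k < d) (k < size s))%N; last first.
  rewrite -(big_mkord xpredT (fun k => nat_of_bool (k < size s)%N)) (big_cat_nat (n := size s)) //=.
  rewrite [X in (_ + X)%N](_ : _ = 0%N); last first.
    by rewrite big_nat big1 // => k /andP[+ _]; rewrite leqNgt => /negbTE->.
  rewrite addn0 big_nat (eq_bigr (fun=> 1%N)) => [|k /andP[_ ->] //].
  by rewrite -big_nat sum_nat_const_nat subn0 muln1.
apply: eq_bigr => k _; congr nat_of_bool; apply/asboolP/idP => [[g [ginj gP]]|ks].
  pose h j := sval (g j).
  have hinj : injective h.
    move=> i j; rewrite /h => ij; apply: ginj.
    by case: (g i) (g j) ij => [x xp] [y yp]; apply: eq_exist.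
  have := uniq_leq_size (s1 := codom h) (s2 := s).
  rewrite size_codom card_ord; apply; first by rewrite map_inj_uniq ?enum_uniq.
  move=> _ /codomP[j ->]; rewrite sP; have [adj col] := gP j.
  by apply/andP; split; [exact: adj|apply/eqP; exact: col].
have within u : u \in s -> @rc_within S 1 (RCGraph e v f) u.
  by rewrite sP => /andP[vu _]; exists [:: u]; split; rewrite //= vu.
have js (j : 'I_k.+1) : (j < size s)%N by apply: leq_trans (ltn_ord j) ks.
exists (fun j : 'I_k.+1 => exist _ (nth v s j) (within _ (mem_nth v (js j)))); split.
  by move=> i j /(congr1 sval) /= /eqP; rewrite nth_uniq // => /eqP/val_inj.
move=> j; rewrite /=.
by have := mem_nth v (js j); rewrite sP => /andP[-> /eqP ->].
Qed.

End NeighborCount.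

Section LimitEdgeLaw.
Variables (R : realType) (d : nat) (S : finPointedType).

(** The test function for [bs_limit] at radius 1: summed over a graph it gives the edge frequency,
    and averaged over the tree it gives d times the edge marginal. *)
Definition root_edge_count (a b : S) (A : rcgraph S) : R :=
  if rc_color (rc_root A) == a then (nbr_count d b A)%:R else 0.

Lemma root_edge_count_iso a b A B : rc_iso A B ->
  root_edge_count a b A = root_edge_count a b B.
Proof.
move=> AB; rewrite /root_edge_count (nbr_count_iso d b AB).
by case: AB => h [_ <- _ ->].
Qed.

Lemma root_edge_count_bounded a b : exists M : R, forall A, `|root_edge_count a b A| <= M.
Proof.
exists d%:R => A; rewrite /root_edge_count; case: ifP => _; last by rewrite normr0 ler0n.
rewrite ger0_norm ?ler0n // ler_nat /nbr_count.
apply: (@leq_trans (\sum_(k < d) 1)); first by apply: leq_sum => k _; apply: leq_b1.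
by rewrite sum_nat_const card_ord muln1.
Qed.

Lemma graph_edge_freqE n (G : regular_graph d n) (f : {ffun 'I_n -> S}) a b :
  graph_edge_freq G f (a, b) =
  (\sum_v if f v == a then #|[set u | graph_adj G v u && (f u == b)]%SET| else 0)%N.
Proof.
rewrite /graph_edge_freq -sum1_card (partition_big fst predT) //=.
apply: eq_bigr => v _; rewrite sum1_card.
case: eqP => [va|nva].
  rewrite -(card_imset (mem [set u | graph_adj G v u && (f u == b)]%SET) (f := pair v)); last first.
    by move=> ? ? [].
  apply: eq_card => -[x y]; rewrite unfold_in /=; apply/andP/imsetP => [[+ /eqP /= <-]|[u]].
    rewrite inE xpair_eqE /= => /and3P[xyG _ yb].
    by exists y => //; rewrite inE /graph_adj xyG yb.
  rewrite inE /graph_adj => /andP[vu ub] [-> ->]; split => //.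
  by rewrite inE xpair_eqE /= vu va eqxx ub.
apply: eq_card0 => -[x y]; rewrite unfold_in /= inE xpair_eqE /=.
by apply/negP => /andP[/and3P[_ /eqP xa _] /eqP xv]; rewrite xv in xa.
Qed.

Lemma sum_root_edge_count n (G : regular_graph d n) (f : {ffun 'I_n -> S}) a b :
  \sum_(v < n) root_edge_count a b (rc_ball 1 (RCGraph (graph_adj G) v f)) =
  (graph_edge_freq G f (a, b))%:R.
Proof.
rewrite graph_edge_freqE natr_sum; apply: eq_bigr => v _.
rewrite /root_edge_count /=; case: ifP => // _; congr (_%:R).
rewrite (@nbr_count_ball _ d _ _ _ _ b (enum [set u | graph_adj G v u && (f u == b)]%SET)).
- by rewrite cardE.
- exact: enum_uniq.
- rewrite -cardE; have /and3P[_ _ /forallP/(_ v)/eqP reg] := valP G.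
  apply: leq_trans (eq_leq reg); apply: subset_leq_card.
  by apply/fintype.subsetP => u; rewrite !inE => /andP[].
- by move=> u; rewrite mem_enum inE.
Qed.

Lemma root_edge_count_tree (w : tree d -> S) a b :
  root_edge_count a b (rc_ball 1 (RCGraph (@tree_adj d) (tree_root d) w)) =
  \sum_(c < d) ((w (tree_root d) == a) && (w (tree_act c (tree_root d)) == b))%:R.
Proof.
rewrite /root_edge_count /=; case: eqP => _; last by rewrite big1.
pose s := [seq tree_act c (tree_root d) | c <- enum 'I_d & w (tree_act c (tree_root d)) == b].
have inj : injective (fun c : 'I_d => tree_act c (tree_root d)).
  by move=> c c' /(congr1 val) /= [].
rewrite (@nbr_count_ball _ d _ _ _ _ b s).
- rewrite size_map size_filter -sum1_count big_enum_cond /= -natr_sum big_mkcond /=.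
  by congr (_%:R); apply: eq_bigr => c _; case: eqP.
- by rewrite map_inj_uniq // filter_uniq // enum_uniq.
- rewrite size_map size_filter; apply: leq_trans (count_size _ _) _.
  by rewrite size_enum_ord.
- move=> u; apply/mapP/andP => [[c]|[/tree_adjP[c ->] cb]].
    rewrite mem_filter => /andP[cb _] ->; split=> //; by apply/tree_adjP; exists c.
  by exists c; rewrite // mem_filter cb mem_enum.
Qed.

Variable nu : probability (borel_coloring d S) R.
Hypothesis nu_inv : invariant_process nu.

Lemma integral_root_edge_count (c0 : 'I_d) a b :
  \int[nu]_w root_edge_count a b (rc_ball 1 (RCGraph (@tree_adj d) (tree_root d) w)) =
  d%:R * edge_law nu c0 (a, b).
Proof.
pose E c := [set w : borel_coloring d S | w (tree_root d) = a /\ w (tree_act c (tree_root d)) = b].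
have mE c : measurable (E c) := measurable_edge_color _ _ _ _.
rewrite /Rintegral.
transitivity (fine (\int[nu]_w (\sum_(c < d) (\1_(E c) w)%:E))).
  congr fine; apply: eq_integral => w _; rewrite root_edge_count_tree sumEFin.
  congr (_%:E); apply: eq_bigr => c _; rewrite indicE; congr (_%:R).
  congr nat_of_bool; apply/andP/idP => [[/eqP h1 /eqP h2]|].
    by rewrite inE; split.
  by rewrite inE => -[/= -> ->].
rewrite ge0_integral_sum //; last first.
  by move=> c; apply/measurable_EFinP; exact: measurable_indic.
rewrite -sum_fine; last first.
  by move=> c _; rewrite integral_indic // setIT fin_num_measure.
rewrite mulr_natl -[in X in _ *+ X](card_ord d) -sumr_const; apply: eq_bigr => c _.
by rewrite integral_indic // setIT (edge_law_const nu_inv c0 c).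
Qed.

Lemma bs_limit_edge_freq (c0 : 'I_d) (ns : nat -> nat) (G : forall i, regular_graph d (ns i))
    (f : forall i, 'I_(ns i) -> S) :
  bs_limit G f nu -> forall ab,
  (graph_edge_freq (G i) [ffun v => f i v] ab)%:R / (d * ns i)%:R @[i --> \oo]
    --> edge_law nu c0 ab.
Proof.
move=> lim [a b].
have d0 : d%:R != 0 :> R by rewrite pnatr_eq0; case: d c0 => // -[].
have := lim 1%N (root_edge_count a b) (@root_edge_count_iso a b) (root_edge_count_bounded a b).
rewrite (integral_root_edge_count c0) => h.
have := cvgM (cvg_cst (d%:R^-1 : R)) h; rewrite mulKf // => {}h.
rewrite [X in X @ _ --> _](_ : _ = (fun i => d%:R^-1 * ((ns i)%:R^-1 * (\sum_(v < ns i)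
   root_edge_count a b (rc_ball 1 (RCGraph (graph_adj (G i)) v (f i)))))));
  first exact: h.
apply/funext => i; set fi := [ffun v => f i v].
have -> : f i = fi :> ('I_(ns i) -> S) by apply/funext => v; rewrite ffunE.
by rewrite sum_root_edge_count natrM invfM mulrC mulrA.
Qed.

End LimitEdgeLaw.

Lemma uniform_graph_law (R : realType) (d : nat) (ns : nat -> nat) (disp : measure_display)
    (Omega : measurableType disp) (P : probability Omega R)
    (G : forall i, Omega -> regular_graph d (ns i)) i (A : {set regular_graph d (ns i)}) :
  independent_uniform P G ->
  P [set w | G i w \in A] = (#|A|%:R / #|{: regular_graph d (ns i)}|%:R)%:E.
Proof.
case=> mG uG _.
have -> : [set w | G i w \in A] = \bigcup_(H in [set` enum A]) (G i @^-1` [set H]).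
  apply/seteqP; split => w /=; first by move=> GA; exists (G i w); rewrite //= mem_enum.
  by case=> H /=; rewrite mem_enum => HA ->.
rewrite measure_fin_union.
- under eq_bigr do rewrite uG.
  by rewrite sumEFin sumr_const mulr_natl.
- by move=> H; apply: mG.
- by apply/trivIsetP => H H' _ _ HH'; apply/seteqP; split => w //= [-> e]; rewrite e eqxx in HH'.
Qed.

(** Almost surely the random graphs eventually have a colouring with edge frequencies near the
    limit. Continuity of the measure along the increasing events [F m] gives one index where this
    has probability above 1/2, which under the uniform law means a majority of the graphs. *)
Lemma typical_graphs (R : realType) (d : nat) (S : finPointedType)
    (nu : probability (borel_coloring d S) R) (c0 : 'I_d) (eps : R) (N0 : nat) :
  invariant_process nu -> typical nu -> 0 < eps ->
  exists n, [/\ (N0 <= n)%N, ~~ odd (d * n) & exists A : {set regular_graph d n},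
    (forall G, G \in A -> exists f : {ffun 'I_n -> S}, forall ab,
       `|(graph_edge_freq G f ab)%:R / (d * n)%:R - edge_law nu c0 ab| <= eps) /\
    (#|{: regular_graph d n}| < 2 * #|A|)%N].
Proof.
move=> nu_inv [ns [_ evn nsoo]].
move=> [disp [T [P [G]]]] [indep aeG] eps0.
pose close i (H : regular_graph d (ns i)) := exists f : {ffun 'I_(ns i) -> S}, forall ab,
  `|(graph_edge_freq H f ab)%:R / (d * ns i)%:R - edge_law nu c0 ab| <= eps.
pose A i := [set H : regular_graph d (ns i) | `[< close i H >]]%SET.
pose E i := [set w | G i w \in A i].
have mE i : measurable (E i) by case: indep => mG _ _; exact: (mG i [set` A i]).
pose F m := \bigcap_(i in [set i | (m <= i)%N]) E i.
have mF m : measurable (F m) by apply: bigcap_measurableType.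
have mUF : measurable (\bigcup_m F m) by exact: bigcupT_measurable.
have aeF : P (\bigcup_m F m) = 1%E.
  have : P.-negligible (~` \bigcup_m F m).
    apply: negligibleS aeG; apply: subsetC => w [_ _ [f bs]].
    have lim := bs_limit_edge_freq nu_inv (c0 := c0) bs.
    have : \forall i \near \oo, close i (G i w).
      have : \forall i \near \oo, forall ab,
         `|(graph_edge_freq (G i w) [ffun v => f i v] ab)%:R / (d * ns i)%:R -
           edge_law nu c0 ab| <= eps.
        apply: filter_forall => ab.
        have /cvgrPdist_le/(_ eps eps0) := lim ab.
        by apply: filterS => i; rewrite distrC.
      by apply: filterS => i h; exists [ffun v => f i v].
    case=> m _ hm; exists m => // i mi; rewrite /E /= inE.
    by apply/asboolP; apply: hm.
  move=> /(negligibleP P (measurableC mUF)) /esym h0.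
  have {h0} := etrans h0 (probability_setC P mUF).
  have fin : P (\bigcup_m F m) \is a fin_num by apply: fin_num_measure.
  by rewrite -(fineK fin) -EFinB => -[] /esym/eqP; rewrite subr_eq0 => /eqP <-.
have ndF : {homo F : n m / (n <= m)%N >-> (n <= m)%O}.
  by move=> n m nm; apply/subsetPset => w Fw i mi; apply: Fw => /=; apply: leq_trans mi.
have cF : P (F m) @[m --> \oo] --> 1%E by rewrite -aeF; exact: nondecreasing_cvg_mu.
have cfF : fine (P (F m)) @[m --> \oo] --> (1 : R) by exact: fine_cvg cF.
have half : \forall m \near \oo, 2^-1 < fine (P (F m)).
  by apply: (cvgr_gt _ cfF); rewrite invf_lt1 ?ltr1n ?ltr0n.
have large : \forall m \near \oo, (N0 <= ns m)%N.
  by apply: (nsoo (fun n => is_true (N0 <= n)%N)); exact: nbhs_infty_ge.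
have [m [h1 h2]] : exists m, 2^-1 < fine (P (F m)) /\ (N0 <= ns m)%N.
  by have [m hm] := filter_ex (filterI half large); exists m.
exists (ns m); split => //; exists (A m); split.
  by move=> H; rewrite inE => /asboolP.
have h3 : (P (F m) <= P (E m))%E.
  by apply: le_measure; rewrite ?inE //; apply: bigcap_inf => /=.
have {}h3 : 2^-1 < #|A m|%:R / #|{: regular_graph d (ns m)}|%:R :> R.
  apply: lt_le_trans h1 _; rewrite -lee_fin -(uniform_graph_law _ indep) fineK //.
  by apply: fin_num_measure.
(* With no graph the quotient would be 0 by the convention on division, against the bound 1/2. *)
have all0 : (0 < #|{: regular_graph d (ns m)}|)%N.
  by rewrite lt0n; apply: contraTneq h3 => ->; rewrite invr0 mulr0 -leNgt invr_ge0.
move: h3; rewrite ltr_pdivlMr ?ltr0n // ltr_pdivrMl ?ltr0n // -natrM ltr_nat //.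
Qed.

(** * Continuity of the entropy *)

Section EntropyContinuity.
Variable R : realType.

(** For 0 < x and s = sqrt x, |x ln x| = 2 s^2 ln (1/s) and ln (1/s) < 1/s. For x <= 0 the
    convention [ln x = 0] applies. This gives continuity at 0. *)
Lemma xlnx_bound (x : R) : x < 1 -> `|x * ln x| <= 2 * Num.sqrt `|x|.
Proof.
move=> x1; have [x0|x0] := lerP x 0.
  by rewrite ln0 // mulr0 normr0 mulr_ge0 ?ler0n ?sqrtr_ge0.
have s0 : 0 < Num.sqrt x by rewrite sqrtr_gt0.
rewrite normrM (gtr0_norm x0) ler0_norm ?ln_le0 ?(ltW x1) //.
set s := Num.sqrt x in s0 *.
have -> : x = s ^+ 2 by rewrite sqr_sqrtr // ltW.
have -> : ln (s ^+ 2) = - (2 * ln s^-1) by rewrite lnXn // lnV ?posrE //; ring.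
have : ln s^-1 < s^-1 by apply: ln_sublinear; rewrite invr_gt0.
rewrite -(ltr_pM2l s0) mulfV ?gt_eqF //; move: (ln _) => l h; nra.
Qed.

Lemma continuous_xlnx : continuous (fun x : R => x * ln x).
Proof.
move=> x; have [x0|x0|->] := ltgtP x 0.
- apply/cvgrPdist_le => e e0; near=> y.
  have y0 : y < 0 by near: y; exact: lt_nbhsl.
  by rewrite (ln0 (ltW x0)) (ln0 (ltW y0)) !mulr0 subrr normr0 ltW.
- by apply: cvgM; [exact: cvg_id|exact: continuous_ln].
have sq0 : 2 * Num.sqrt `|y| @[y --> (0 : R)] --> (0 : R).
  have -> : (0 : R) = 2 * Num.sqrt `|0 : R| by rewrite normr0 sqrtr0 mulr0.
  rewrite {1}normr0 sqrtr0 mulr0; apply: cvgM; first exact: cvg_cst.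
  apply: (cvg_comp (fun y : R => `|y|) (@Num.sqrt R)); last exact: sqrt_continuous.
  exact: norm_continuous.
rewrite /continuous_at mul0r; apply: squeeze_cvgr (sq0); last first.
  by have := cvgN sq0; rewrite oppr0; exact.
near=> y; rewrite -ler_norml; apply: xlnx_bound.
by near: y; apply: lt_nbhsl.
Unshelve. all: by end_near. Qed.

Lemma cvg_entropy (K : finType) (p : nat -> K -> R) (q : K -> R) :
  (forall k, p i k @[i --> \oo] --> q k) -> entropy (p i) @[i --> \oo] --> entropy q.
Proof.
move=> pq; apply: cvgN; apply: cvg_big => [|k _]; first exact: add_continuous.
exact: (cvg_comp _ (fun x => x * ln x) (pq k) (@continuous_xlnx _)).
Qed.

End EntropyContinuity.

(** A single term of degree m+1 of the exponential series dominates a polynomial of degree m. *)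
Lemma polynomial_le_exp (R : realType) (d m k : nat) : exists N0 : nat, forall n : nat,
  (N0 <= n)%N -> (4 * (d * n).+1 ^ m)%:R <= expR (n%:R / k.+1%:R) :> R.
Proof.
(* The 1 makes n positive, so that d n + 1 <= (d+1) n; the product is what remains after cancelling
   n^m. *)
exists (1 + 4 * d.+1 ^ m * (k.+1 ^ m.+1 * m.+1`!))%N => n nN.
have n0 : (0 < n)%N by apply: leq_trans nN.
apply: le_trans (_ : (n%:R / k.+1%:R) ^+ m.+1 / m.+1`!%:R <= _); last first.
  have h := @expR_ge1Dxn R (n%:R / k.+1%:R) m (divr_ge0 (ler0n _ _) (ler0n _ _)).
  by apply: le_trans h; rewrite lerDr ler01.
rewrite ler_pdivlMr ?ltr0n ?fact_gt0 // expr_div_n ler_pdivlMr ?exprn_gt0 ?ltr0n //.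
rewrite -!natrX -!natrM ler_nat.
apply: (@leq_trans (4 * (d.+1 * n) ^ m * m.+1`! * k.+1 ^ m.+1)).
  rewrite !leq_mul2r leq_mul2l; apply/orP; right; apply/orP; right => /=.
  case: (posnP m) => [->|m0]; first by rewrite !expn0.
  by rewrite leq_exp2r // mulSn -add1n leq_add2r.
rewrite expnMn [X in (_ <= X)%N]expnS.
have -> : (4 * (d.+1 ^ m * n ^ m) * m.+1`! * k.+1 ^ m.+1 =
   4 * d.+1 ^ m * (k.+1 ^ m.+1 * m.+1`!) * n ^ m)%N by ring.
by rewrite leq_mul2r (leq_trans _ nN) ?orbT // leq_addl.
Qed.

(** The growth rate per vertex in the first moment bound; the theorem says that it is nonnegative at
    the edge marginal. *)
Definition bethe_entropy (R : realType) (S : finType) (d : nat) (q : S * S -> R) : R :=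
  d%:R / 2 * entropy q - (d%:R - 1) * entropy (fun a => \sum_b q (a, b)).

Lemma cvg_bethe_entropy (R : realType) (S : finType) (d : nat)
    (p : nat -> S * S -> R) (q : S * S -> R) :
  (forall ab, p i ab @[i --> \oo] --> q ab) ->
  bethe_entropy d (p i) @[i --> \oo] --> bethe_entropy d q.
Proof.
move=> pq; apply: cvgB; (apply: cvgM; first exact: cvg_cst); apply: cvg_entropy => // a.
by apply: cvg_big => [|b _]; [exact: add_continuous|exact: pq].
Qed.

(** The polynomial factor of [edge_freq_counting] is at most exp (n/(k+1)), so the rate at the
    selected frequencies is at least -1/(k+1). *)
Lemma typical_bethe_approx (R : realType) (d : nat) (S : finPointedType)
    (nu : probability (borel_coloring d S) R) (c0 : 'I_d) (k : nat) :
  invariant_process nu -> typical nu ->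
  exists q : S * S -> R, (forall ab, `|q ab - edge_law nu c0 ab| <= k.+1%:R^-1) /\
    - k.+1%:R^-1 <= bethe_entropy d q.
Proof.
move=> nu_inv nu_typ.
have d0 : (0 < d)%N by case: d c0 {nu nu_inv nu_typ} => // -[].
pose K := (2 * (2 * d + 4 * d ^ 2))%N.
have [N1 hN1] := polynomial_le_exp R d (2 * K + (#|S| * #|S| + 2 * #|S|)) k.
(* [N1] is for the exponential comparison; the rest, with 7 = 6 + 1 for strictness, meets the size
   condition of the word count, as n <= d n. *)
pose N0 := (N1 + (7 + d * (d + 2) + d * (d + 1) + K))%N.
have eps0 : 0 < k.+1%:R^-1 :> R by rewrite invr_gt0 ltr0n.
have [n [nN ev [A [Aclose Abig]]]] := typical_graphs c0 N0 nu_inv nu_typ eps0.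
have n0 : (0 < n)%N by apply: leq_trans nN; rewrite /N0 !addnS.
have dn : (n <= d * n)%N by rewrite leq_pmull.
pose Good := [set e : {ffun S * S -> 'I_(d * n).+1} | [forall ab,
  `|(e ab)%:R / (d * n)%:R - edge_law nu c0 ab| <= k.+1%:R^-1]]%SET.
have [||e [eG esum hexp]] := edge_freq_counting R ev d0 n0 _ (A := A) (Good := Good) _ Abig.
- by rewrite -/K; apply: leq_trans dn; apply: leq_trans nN; rewrite /N0; lia.
- move=> G GA; have [f fclose] := Aclose G GA; exists f.
  have bnd ab : (graph_edge_freq G f ab < (d * n).+1)%N.
    rewrite ltnS -(card_regular_graph (valP G)); apply: subset_leq_card.
    by apply/fintype.subsetP => xy; rewrite inE => /andP[].
  exists [ffun ab => Ordinal (bnd ab)]; last by move=> ab; rewrite ffunE.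
  by rewrite inE; apply/forallP => ab; rewrite ffunE /=.
exists (fun ab => (e ab)%:R / (d * n)%:R); split.
  by move=> ab; move: eG; rewrite inE => /forallP.
rewrite /bethe_entropy.
under [X in _ - _ * entropy X]eq_fun do rewrite -mulr_suml -natr_sum.
set F := _ - _ in hexp *.
have : 1 <= expR (n%:R / k.+1%:R + n%:R * F).
  apply: le_trans hexp _; rewrite expRD ler_wpM2r ?expR_ge0 //.
  apply: le_trans (hN1 n _); last by apply: leq_trans nN; rewrite leq_addr.
  rewrite ler_nat -mulnA leq_mul2l (expnD _ (2 * K)) leq_mul2r; apply/orP; right; apply/orP; right.
  have [->|K0] := posnP (2 * K)%N; first by rewrite !expn0.
  by rewrite leq_exp2r // leqnSn.
rewrite -[X in X <= _]expR0 ler_expR -mulrDr pmulr_rge0 ?ltr0n //.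
by move=> h; rewrite -subr_ge0 opprK addrC.
Qed.

Lemma typical_bethe_ge0 (R : realType) (d : nat) (S : finPointedType)
    (nu : probability (borel_coloring d S) R) (c0 : 'I_d) :
  invariant_process nu -> typical nu -> 0 <= bethe_entropy d (edge_law nu c0).
Proof.
move=> nu_inv nu_typ.
have [q qP] := choice (fun k => typical_bethe_approx c0 k nu_inv nu_typ).
have qcvg ab : q k ab @[k --> \oo] --> edge_law nu c0 ab.
  apply/cvgrPdist_le => e e0; near=> k.
  have [/(_ ab) + _] := qP k; rewrite distrC => /le_trans; apply.
  near: k; have /cvgrPdist_le/(_ e e0) := @cvg_harmonic R.
  by apply: filterS => k; rewrite sub0r normrN ger0_norm ?invr_ge0 ?ler0n.
have h0 : - harmonic k @[k --> \oo] --> (0 : R).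
  by rewrite -[X in _ --> X]oppr0; apply: cvgN; exact: cvg_harmonic.
apply: (ler_cvg_to h0 (cvg_bethe_entropy (d := d) qcvg)).
by near=> k; case: (qP k).
Unshelve. all: by end_near. Qed.

End TypicalProcesses.

Theorem theorem3 (R : realType) (d : nat) (S : finPointedType)
    (nu : probability (borel_coloring d S) R) :
  (2 <= d)%N ->
  invariant_process nu ->
  typical nu ->
  forall v x y : tree d, tree_adj x y ->
    d%:R / 2 * h_edge nu x y >= (d%:R - 1) * h_vertex nu v.
Proof.
move=> d2 nu_inv nu_typ v x y xy.
pose c0 := Ordinal (ltnW d2).
rewrite (h_edge_law nu_inv c0 xy) (h_vertex_law nu_inv c0) -subr_ge0.
exact: typical_bethe_ge0.
Qed.
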